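(* Let $G$ be a noncompact amenable locally compact group, and let $\Gamma$, $\{F_\gamma\}_{\gamma\in\Gamma}$, $\lambda_\gamma = 1_{F_\gamma}/|F_\gamma|$ and $\rho_\gamma = \lambda_\gamma^\dag$ be a Følner net and its associated functions, as defined in the context. Then there exists $\{t_\gamma\}_{\gamma\in\Gamma}\in G^\Gamma$ such that the sets $\{F_\gamma t_\gamma F_\gamma^{-1}\}_{\gamma\in\Gamma}$ are mutually disjoint. Consequently, since $\operatorname{supp}(\lambda_\gamma * (l_{t_\gamma}\rho_\gamma)) \subset F_\gamma t_\gamma F_\gamma^{-1}$, the net $\{\lambda_\gamma * (l_{t_\gamma}\rho_\gamma)\}_{\gamma\in\Gamma}$ is an orthogonal (two-sided) TI-net in $\mathcal P_1(G)$.
   Context: For $E\subset G$, $|E|$ denotes left Haar measure; integrals are with respect to left Haar measure. The modular function $\triangle$ is defined by $|Ut| = |U|\triangle(t)$. For $f\in L_1(G)$, $f^\dag(x) = f(x^{-1})\triangle(x^{-1})$ and $l_t f(x) = f(t^{-1}x)$. $L_\infty(G)$ is the dual of $L_1(G)$. $\mathcal P_1(G) = \{f\in L_1(G) : f\ge 0, \|f\|_1 = 1\}$, and $\operatorname{supp}(f) = \{x : f(x)\neq 0\}$. Elements $f,g\in\mathcal P_1(G)$ are orthogonal if their support projections in $L_\infty(G)$ (the indicator functions of $\operatorname{supp}(f)$, $\operatorname{supp}(g)$) have product $0$; a net is orthogonal if members with distinct indices are orthogonal. A net $\{f_\gamma\}\subset\mathcal P_1(G)$ is a left TI-net if $\|g*f_\gamma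 - f_\gamma\|_1\to 0$ for all $g\in\mathcal P_1(G)$, a right TI-net if $\|f_\gamma * g - f_\gamma\|_1\to0$ for all $g\in\mathcal P_1(G)$, and a two-sided TI-net (or TI-net) if it is both. Følner net: let $\kappa$ be the least cardinal such that $G$ is the union of $\kappa$ compact subsets. Let $\mathcal K$ be a collection of compact subsets of $G$ with $|\mathcal K| = \kappa$ (cardinality), closed under finite unions, and with $\bigcup_{K\in\mathcal K}K^\circ = G$. Let $\Gamma = \{(K,n) : K\in\mathcal K,\ n \text{ a positive integer}\}$, directed by $(K,m)\preceq(J,n)\iff K\subseteq J$ and $m\le n$. For each $\gamma = (K,n)\in\Gamma$, $F_\gamma\subset G$ is a compact set of positive measure such that $\lambda_\gamma = 1_{F_\gamma}/|F_\gamma|$ satisfies $\|l_x\lambda_\gamma - \lambda_\gamma\|_1 < \frac1n$ for each $x\in K$. *)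

(* Defs.v *)
From HB Require Import structures.
From mathcomp Require Import all_boot all_order all_algebra.
From mathcomp Require Import all_classical all_reals all_analysis.

Set Implicit Arguments.
Unset Strict Implicit.
Unset Printing Implicit Defensive.

Import Order.TTheory GRing.Theory Num.Theory.
Import numFieldNormedType.Exports.

Local Open Scope classical_set_scope.
Local Open Scope ring_scope.

(* The library's measurable types are pointed, so the carrier is required to be
   pointed; the distinguished point plays no role (any group is pointed by 1). *)
HB.mixin Record isTopologicalGroup G of Topological G & Group G := {
  mulg_continuous : continuous (fun p : G * G => (p.1 * p.2)%g : G) ;
  invg_continuous : continuous (fun x : G => (x^-1)%g : G)
}.

#[short(type="topologicalGroupType")]
HB.structure Definition TopologicalGroup :=
  {G of PointedTopological G & Group G & isTopologicalGroup G}.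

Definition borel (G : topologicalGroupType) := g_sigma_algebraType (@open G).

Section Haar.
Context (R : realType) (G : topologicalGroupType).
Implicit Types (mu : {measure set (borel G) -> \bar R}) (f g : G -> R).

(* Nonzero left-invariant Radon measure on the Borel sets, where Radon means
   finite on compact sets, outer regular on Borel sets and inner regular on
   open sets. *)
Record left_haar_measure mu : Prop := {
  haar_nonzero : mu [set: G] != 0%E ;
  haar_compact : forall K : set G, compact K -> (mu K < +oo)%E ;
  haar_outer : forall A : set (borel G), measurable A ->
    mu A = ereal_inf [set mu U | U in [set U : set G | open U /\ A `<=` U]] ;
  haar_inner : forall U : set G, open U ->
    mu U = ereal_sup [set mu K | K in [set K : set G | compact K /\ K `<=` U]] ;
  haar_left_invariant : forall (t : G) (A : set (borel G)), measurable A ->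
    mu [set (t * x)%g | x in (A : set G)] = mu A
}.

Definition modular_function mu (Delta : G -> R) : Prop :=
  forall (t : G) (U : set (borel G)), measurable U ->
    mu [set (x * t)%g | x in (U : set G)] = (mu U * (Delta t)%:E)%E.

Definition L1 mu : set (G -> R) := [set f | (f : borel G -> R) \in Lfun mu 1].

Definition L1norm mu f : \bar R := 'N[mu]_1[EFin \o (f : borel G -> R)].

Definition P1 mu : set (G -> R) :=
  [set f | [/\ L1 mu f, {ae mu, forall x : borel G, 0 <= f x} &
               L1norm mu f = 1%E]].

Definition ltrans (t : G) f : G -> R := fun x => f (t^-1 * x)%g.

Definition dagger (Delta : G -> R) f : G -> R :=
  fun x => f (x^-1)%g * Delta (x^-1)%g.

Definition convol mu f g : G -> R :=
  fun x => \int[mu]_y (f (y : G) * g ((y : G)^-1 * x)%g).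

Definition supp f : set G := [set x | f x != 0].

(* The supports of integrable functions are sigma-finite, so that for a product
   of their indicators vanishing in the dual of L_1 (i.e. locally almost
   everywhere) is the same as vanishing almost everywhere. *)
Definition orthogonal_supp mu f g : Prop :=
  {ae mu, forall x : borel G,
    \1_(supp f) (x : G) * \1_(supp g) (x : G) = 0 :> R}.

(* L_infty(G), defined as the dual of L_1(G). Its elements are represented by
   maps on all functions, of which only the values on L_1(G) are meaningful. *)
Definition Linfty mu : set ((G -> R) -> R) := [set phi |
  (forall (a : R) f g, L1 mu f -> L1 mu g ->
     phi (fun x => a * f x + g x) = a * phi f + phi g) /\
  (exists C : R, forall f, L1 mu f ->
     (`|phi f|%:E <= C%:E * L1norm mu f)%E)].

Definition Linfty_nonneg mu (phi : (G -> R) -> R) : Prop :=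
  forall f, L1 mu f -> {ae mu, forall x : borel G, 0 <= f x} -> 0 <= phi f.

Definition Linfty_one mu : (G -> R) -> R := fun f => \int[mu]_x f (x : G).

(* Translation by t of phi in L_infty(G); for phi given by a bounded function h
   this is translation of h by t, since
   \int h (t^-1 x) f x dx = \int h x f (t x) dx. *)
Definition Linfty_ltrans (t : G) (phi : (G -> R) -> R) : (G -> R) -> R :=
  fun f => phi (ltrans (t^-1)%g f).

(* A mean does not depend on the representatives: linearity and positivity give
   it the same value on maps that agree on L_1(G). *)
Record left_invariant_mean mu (m : ((G -> R) -> R) -> R) : Prop := {
  mean_linear : forall (a : R) phi psi, Linfty mu phi -> Linfty mu psi ->
    m (fun f => a * phi f + psi f) = a * m phi + m psi ;
  mean_nonneg : forall phi, Linfty mu phi -> Linfty_nonneg mu phi -> 0 <= m phi ;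
  mean_one : m (Linfty_one mu) = 1 ;
  mean_left_invariant : forall t phi, Linfty mu phi ->
    m (Linfty_ltrans t phi) = m phi
}.

Definition amenable mu : Prop := exists m, left_invariant_mean mu m.

End Haar.

(* A net is a family indexed by the elements of D : set I, directed by le. *)
Definition net_filter (I : Type) (D : set I) (le : I -> I -> Prop) :
    set_system I :=
  [set P | exists2 i0, D i0 & forall i, D i -> le i0 i -> P i].

Section Nets.
Context (R : realType) (G : topologicalGroupType).
Variable mu : {measure set (borel G) -> \bar R}.
Context (I : Type) (D : set I) (le : I -> I -> Prop).
Implicit Type f : I -> G -> R.

Definition net_in_P1 f : Prop := forall i, D i -> P1 mu (f i).

Definition orthogonal_net f : Prop :=
  forall i j, D i -> D j -> i <> j -> orthogonal_supp mu (f i) (f j).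

Definition left_TI_net f : Prop := net_in_P1 f /\
  forall g : G -> R, P1 mu g ->
    L1norm mu (convol mu g (f i) \- f i) @[i --> net_filter D le] --> 0%E.

Definition right_TI_net f : Prop := net_in_P1 f /\
  forall g : G -> R, P1 mu g ->
    L1norm mu (convol mu (f i) g \- f i) @[i --> net_filter D le] --> 0%E.

Definition TI_net f : Prop := left_TI_net f /\ right_TI_net f.

End Nets.

Section Folner.
Context (R : realType) (G : topologicalGroupType).
Variable mu : {measure set (borel G) -> \bar R}.

Definition compact_cover (C : set (set G)) : Prop :=
  (forall A, C A -> compact A) /\ \bigcup_(A in C) A = [set: G].

(* C0 represents the least cardinal kappa such that G is the union of kappa
   compact subsets. *)
Definition has_compact_covering_card (calK : set (set G)) : Prop :=
  exists C0 : set (set G), [/\ compact_cover C0,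
    (forall C, compact_cover C -> (C0 #<= C)%card) & (calK #= C0)%card].

Definition folner_index (calK : set (set G)) : set (set G * nat) :=
  [set gam | calK gam.1 /\ (0 < gam.2)%N].

Definition folner_le (gam del : set G * nat) : Prop :=
  gam.1 `<=` del.1 /\ (gam.2 <= del.2)%N.

Definition unif (F : set G) : G -> R := fun x => \1_F x / fine (mu F).

Record folner_net (calK : set (set G)) (F : set G * nat -> set G) : Prop := {
  folner_calK_compact : forall K, calK K -> compact K ;
  folner_calK_card : has_compact_covering_card calK ;
  folner_calK_setU : forall K J, calK K -> calK J -> calK (K `|` J) ;
  folner_calK_cover : \bigcup_(K in calK) K° = [set: G] ;
  folner_compact : forall gam, folner_index calK gam -> compact (F gam) ;
  folner_pos : forall gam, folner_index calK gam -> (0 < mu (F gam))%E ;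
  folner_lt : forall gam, folner_index calK gam -> forall x : G, gam.1 x ->
    (L1norm mu (ltrans x (unif (F gam)) \- unif (F gam))%R <
       ((gam.2)%:R^-1 : R)%:E)%E
}.

End Folner.

Arguments folner_le {G} gam del.

Definition FtFinv (G : groupType) (F : set G) (t : G) : set G :=
  [set (x * t * y^-1)%g | x in F & y in F].

(* Main.v *)
(** Write [rho^t] for the translate of [rho] by [t], and [phi_t] for the
    convolution [lambda * rho^t].  Disjointness: [Gamma] has cardinality [kappa],
    hence a well-order all of whose proper initial segments have cardinality less
    than [kappa]; at stage [gamma] the forbidden [t] lie in fewer than [kappa]
    compact sets [F_gamma^-1 F_beta t_beta F_beta^-1 F_gamma], which cannot
    cover [G].

    Left invariance: [g * phi_t - phi_t = (g * lambda - lambda) * rho^t] has norm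
    at most the integral of [g(y) |l_y lambda - lambda|_1], which is small by
    tightness of [g] and the Folner condition.  Right invariance follows because
    the involution [dagger] maps [phi_t] to [phi_(t^-1)].

    The group need not be second countable, so [(x, y) |-> f (x^-1 y)] need not be
    measurable for the product of the Borel sigma-algebras and Tonelli's theorem
    does not apply directly.  Each [F_gamma] is therefore enlarged by a null set to
    a compact [G_delta] set, for which such maps are product measurable on
    sigma-compact rectangles, and every [g] in [P1] is replaced by an almost
    everywhere equal function living on a sigma-compact set. *)

From HB Require Import structures.
Require Import Defs.
From mathcomp Require Import all_boot all_order all_algebra ring.
From mathcomp Require Import all_classical all_reals all_analysis.
From mathcomp Require Import borel_hierarchy measurable_realfun.
From mathcomp Require wochoice.
From Stdlib Require Wellfounded.

Set Implicit Arguments.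
Unset Strict Implicit.
Unset Printing Implicit Defensive.

Import Order.TTheory GRing.Theory Num.Theory.
Import numFieldNormedType.Exports.

Local Open Scope classical_set_scope.
Local Open Scope ring_scope.

(** * Cardinality and transfinite selection *)

(** All norm estimates are uniform in the translating elements t, so these can be chosen for
    disjointness alone. [Gamma] has cardinality kappa because noncompactness makes kappa infinite,
    and then kappa times aleph_0 is kappa.

    The passage through [dagger] rests on the inversion formula: the measure of A^-1 is the integral
    of Delta(x^-1) over A. It is derived from the scaling of [mu] under right translation, and its
    usual proof by Tonelli meets the same measurability obstacle. Compact G_delta sets overcome it:
    if C is the part of the preimage of such a set in a compact rectangle, each open set of the
    defining sequence pulls back to a neighbourhood of C, and a finite union of open rectangles fits
    between C and that neighbourhood; hence C is product measurable. Sigma-finiteness, which [mu]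
    itself may lack, is recovered by restricting [mu] to sigma-compact sets. *)

Lemma card_setX_nat_le (T : pointedType) (A : set T) :
  infinite_set A -> (A `*` [set: nat] #<= A)%card.
Proof.
move=> infA.
pose B := [set X : set T | [/\ X `<=` A, infinite_set X & countable X]].
have [E [EB tE maxE]] := @ex_maximal_disjoint_subcollection _ _ id B.
pose rest := A `\` \bigcup_(X in E) X.
(* A countably infinite subset of the remainder would be disjoint from all members of [E] and could
   be added to [E], against maximality. *)
have finrest : finite_set rest.
  apply: contrapT => /infiniteP/pcard_leP[f].
  pose X := f @` [set: nat].
  have Xrest : X `<=` rest by move=> _ [n _ <-]; exact: funS.
  have nEX : ~ E X.
    move=> EX; have [_] : rest (f 0%N) by apply: Xrest; exists 0%N.
    by apply; exists X => //; exists 0%N.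
  have BX : B X.
    split; first by move=> x /Xrest[].
      apply: (contra_not _ infinite_nat) => /card_le_finite; apply.
      by rewrite (card_le_eqr (inj_card_eq _)).
    exact/(card_le_trans (card_image_le f _))/countableP.
  apply: (maxE (E `|` [set X])).
  - split; first exact: subsetUl.
    by move=> /(_ X) h; apply: nEX; apply: h; right.
  - by move=> Y [/EB//|->].
  - move=> Y Z /= EY EZ [x [Yx Zx]].
    case: EY EZ Yx Zx => [EY|->] [EZ|->] Yx Zx //.
    + by apply: tE => //; exists x.
    + by have [_] := Xrest _ Zx; case; exists Y.
    + by have [_] := Xrest _ Yx; case; exists Z.
have [D0 ED0] : E !=set0.
  apply/set0P/eqP => E0; apply: infA.
  by move: finrest; rewrite /rest E0 bigcup_set0 setD0.
(* The classes [p x] partition [A] into countably infinite sets: the members of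
   a maximal disjoint family [E] of such sets, the finite remainder being absorbed
   into [D0]. *)
pose p x := [set y | A y /\ forall D, E D -> D <> D0 -> (D x <-> D y)].
have pxx x : A x -> p x x by [].
have pyx x y : p x y -> p y = p x.
  move=> [Ay xy]; apply/seteqP; split=> z [Az h]; split => // D ED DD0.
    by rewrite xy// h.
  by rewrite -xy// h.
have Einf x : A x -> infinite_set (p x) /\ countable (p x).
  move=> Ax; case: (pselect (exists2 D, E D /\ D <> D0 & D x)).
    move=> [D [ED DD0] Dx]; have -> : p x = D.
      apply/seteqP; split=> y; first by move=> [_ /(_ D ED DD0)[+ _]]; apply.
      move=> Dy; split; first by have [+ _ _] := EB _ ED; exact.
      move=> D' ED' D'D0; split=> D'z.
        by have <- : D = D' by apply: tE => //; exists x.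
      by have <- : D = D' by apply: tE => //; exists y.
    by have [] := EB _ ED.
  move=> nD; have [D0A D0i D0c] := EB _ ED0; split.
    apply: sub_infinite_set D0i => y D0y; split; first exact: D0A.
    move=> D ED DD0; split=> [Dx|Dy].
      by exfalso; apply: nD; exists D.
    by exfalso; apply: DD0; apply: tE => //; exists y.
  apply: (@sub_countable _ _ _ (D0 `|` rest)); last first.
    rewrite -bigcup2E; apply: bigcup_countable => // -[|[|i]] _ //=.
    exact: finite_set_countable.
  apply: subset_card_le => y [Ay h].
  have [D0y|nD0y] := pselect (D0 y); [by left|right].
  split=> // -[D ED Dy]; apply: nD; exists D.
    by split => // DD0; apply: nD0y; rewrite -DD0.
  by apply/h => // DD0; apply: nD0y; rewrite -DD0.
(* The injection is a function of the class [C], so that all points of one class share it. Its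
   values stay in the class, so equal values come from the same class. *)
have /choice[j jP] : forall C : set T, exists j : T * nat -> T,
    (exists2 x, A x & C = p x) ->
    set_fun (C `*` [set: nat]) C j /\ set_inj (C `*` [set: nat]) j.
  move=> C; case: (pselect (exists2 x, A x & C = p x)); last by exists (fun=> point).
  move=> [x Ax Cx]; have [Ci Cc] := Einf _ Ax; rewrite -Cx in Ci Cc.
  have /pcard_leP[f] : (C `*` [set: nat] #<= C)%card.
    apply: (@card_le_trans _ _ _ [set: nat]); last exact/infiniteP.
    by apply: countableX => //; exact: countableP.
  by exists f => _; split; [exact: funS|exact: inj].
have jpP x : A x -> set_fun (p x `*` [set: nat]) (p x) (j (p x)) /\
     set_inj (p x `*` [set: nat]) (j (p x)).
  by move=> Ax; apply: jP; exists x.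
apply/pcard_leP/injfunPex; exists (fun z => j (p z.1) z).
  move=> [x n] [/= Ax _]; have [jf _] := jpP _ Ax.
  by have [] : p x (j (p x) (x, n)) by apply: jf; split => //=.
move=> [x n] [y m]; rewrite !inE => -[/= Ax _] [/= Ay _] xy.
have [jfx jix] := jpP _ Ax; have [jfy jiy] := jpP _ Ay.
have px : p x (j (p x) (x, n)) by apply: jfx; split => //; exact: pxx.
have py : p y (j (p y) (y, m)) by apply: jfy; split => //; exact: pxx.
have pE : p x = p y by rewrite -(pyx _ _ px) -(pyx _ _ py) xy.
apply: jix; rewrite ?inE; [by split => //; exact: pxx| |].
  by split => //=; rewrite pE; exact: pxx.
by rewrite xy -pE.
Qed.

(** The strict part of a well-order: a least inaccessible element would have only accessible
    predecessors, hence be accessible. *)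
Lemma well_founded_total_order (T : choiceType) : exists lt : T -> T -> Prop,
  well_founded lt /\ forall x y, x <> y -> lt x y \/ lt y x.
Proof.
have [r wo_r] := wochoice.well_ordering_principle T.
pose lt x y := r x y /\ x <> y.
have rtot x y : r x y || r y x.
  by apply: (wochoice.wo_chainW (C := predT)) => // A _; exact: wo_r.
exists lt; split=> [|x y xy]; last first.
  by have /orP[] := rtot x y => h; [left|right]; split=> // /esym.
have ranti : antisymmetric r.
  by move=> x y h; apply: (@wochoice.wo_chain_antisymmetric _ r predT) => // A _;
    exact: wo_r.
move=> x; apply: contrapT => nAx.
have [|z [[/asboolP nz zmin] _]] := wo_r (fun x => `[< ~ Acc lt x >]).
  by exists x; apply/asboolP.
apply: nz; constructor=> y [yz ynz]; apply: contrapT => nAy.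
apply: ynz; apply: ranti; rewrite yz /= zmin//; exact/asboolP.
Qed.

Lemma well_founded_min (T : Type) (lt : T -> T -> Prop) (P : T -> Prop) :
  well_founded lt -> (exists x, P x) ->
  exists2 x, P x & forall y, lt y x -> ~ P y.
Proof.
move=> wf [x Px]; apply: contrapT => h; move: Px.
by elim: (wf x) => {}x _ IH Px; apply: h; exists x.
Qed.

(* The order type is an initial ordinal. *)
Lemma well_order_initial (T : pointedType) (A : set T) :
  exists lt : T -> T -> Prop,
  [/\ well_founded lt,
      forall x y, A x -> A y -> x <> y -> lt x y \/ lt y x &
      forall x, A x -> ~ (A #<= [set y | A y /\ lt y x])%card].
Proof.
have [lt [wf tot]] := well_founded_total_order T.
pose big x := A x /\ (A #<= [set y | A y /\ lt y x])%card.
have [exb|nb] := pselect (exists x, big x); last first.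
  by exists lt; split=> // [|x Ax h]; [move=> *; exact: tot|apply: nb; exists x].
(* [x0] is the first element whose initial segment is as large as [A]. The order is pulled back
   along the injection [f] of [A] into that segment; a large segment below x would then make [f x]
   an earlier choice than [x0]. *)
have [x0 [Ax0 /pcard_leP[f]] x0min] := well_founded_min wf exb.
have fA x : A x -> A (f x) /\ lt (f x) x0 by exact: 'funS_f.
exists (fun x y => lt (f x) (f y)); split.
- exact: (Inverse_Image.wf_inverse_image _ _ lt f wf).
- move=> x y Ax Ay xy; apply: tot => fxy; apply: xy.
  by apply: 'inj_f => //; rewrite inE.
- move=> x Ax h; apply: (x0min (f x)); first by have [] := fA _ Ax.
  split; first by have [] := fA _ Ax.
  apply: card_le_trans h _; apply/pcard_leP/injfunPex; exists f.
    by move=> y [Ay yx]; split => //; have [] := fA _ Ay.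
  by move=> y z; rewrite !inE => -[Ay _] [Az _]; apply: 'inj_f; rewrite ?inE.
Qed.

(** The order is pulled back along an injection of [D] into [A], which sends initial segments into
    initial segments. It serves for [D] the index set of the net and [A] the family [calK] of
    cardinality kappa. *)
Lemma well_order_card_le (I T : pointedType) (D : set I) (A : set T) :
  (D #<= A)%card ->
  exists lt : I -> I -> Prop,
  [/\ well_founded lt,
      forall i j, D i -> D j -> i <> j -> lt i j \/ lt j i &
      forall i, D i -> ~ (A #<= [set j | D j /\ lt j i])%card].
Proof.
move=> /pcard_leP[f]; have [lt [wf tot small]] := well_order_initial A.
have fA x : D x -> A (f x) by exact: 'funS_f.
exists (fun x y => lt (f x) (f y)); split.
- exact: (Inverse_Image.wf_inverse_image _ _ lt f wf).
- move=> x y Dx Dy xy; apply: tot; [exact: fA..|] => fxy; apply: xy.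
  by apply: 'inj_f => //; rewrite inE.
- move=> x Dx h; apply: (small (f x)); first exact: fA.
  apply: card_le_trans h _; apply/pcard_leP/injfunPex; exists f.
    by move=> y [Ay yx]; split => //; exact: fA.
  by move=> y z; rewrite !inE => -[Ay _] [Az _]; apply: 'inj_f; rewrite ?inE.
Qed.

(** Transfinite recursion under pairwise constraints. The hypothesis quantifies over every [t], so a
    stage never gets stuck, whatever was chosen earlier. *)
Lemma well_founded_choice (I : Type) (T : pointedType) (lt : I -> I -> Prop)
    (P : I -> T -> I -> T -> Prop) (D : set I) : well_founded lt ->
  (forall (t : I -> T) i, D i -> exists x, forall j, D j -> lt j i ->
     P i x j (t j)) ->
  exists t : I -> T, forall i j, D i -> D j -> lt j i -> P i (t i) j (t j).
Proof.
move=> wf ex.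
(* The default [point] makes the step total; on [D] it is never reached as a mere default, since an
   admissible value exists. *)
pose step i (rec : forall j, lt j i -> T) : T :=
  xget point [set x | forall j, D j -> forall ji : lt j i, P i x j (rec j ji)].
pose t := Fix wf (fun=> T) step.
have tE i : t i = step i (fun j _ => t j).
  rewrite /t Fix_eq// => x f g fg; congr step.
  by apply/functional_extensionality_dep => y; apply/funext => yx; exact: fg.
exists t => i j Di Dj ji; rewrite (tE i) /step.
have [x hx] := ex t i Di.
by case: xgetP => [y _ /=|/(_ x)]; [apply|case=> k Dk ki; exact: hx].
Qed.

(** * Topological groups *)

(** The near-covering form of compactness is applied to the filter of families that contain every
    [P]-set above some fixed [P]-set; stability under unions makes this a filter. *)
Lemma compact_induction (T : topologicalType) (P : set T -> Prop) (K : set T) :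
  P set0 -> (forall U V, P U -> P V -> P (U `|` V)) ->
  (forall x, K x -> exists2 U, nbhs x U & P U) ->
  compact K -> exists2 U, K `<=` U & P U.
Proof.
move=> P0 PU loc /compact_near_coveringP cK.
pose F : set_system (set T) :=
  [set Q | exists2 U0, P U0 & forall U, P U -> U0 `<=` U -> Q U].
have FF : Filter F.
  split; first by exists set0.
    move=> Q R [U PU' UQ] [V PV VR]; exists (U `|` V); first exact: PU.
    by move=> W PW; rewrite subUset => -[UW VW]; split; [exact: UQ|exact: VR].
  by move=> Q R QR [U PU' UQ]; exists U => // V PV UV; exact/QR/UQ.
have [x Kx|U PU' /(_ U PU' (@subset_refl _ U))] := cK _ F (fun U x => U x) FF.
  have [U xU PU'] := loc x Kx.
  exists (U, [set V | U `<=` V]) => /=.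
    by split => //; exists U.
  by move=> [y V] /= [Uy UV]; exact: UV.
by exists U.
Qed.

Section TopologicalGroup.
Variable G : topologicalGroupType.
Implicit Types (t : G) (K L U : set G).

Lemma continuous_pair (S T U : topologicalType) (f : S -> T) (g : S -> U) :
  continuous f -> continuous g -> continuous (fun x => (f x, g x)).
Proof. by move=> cf cg x; apply: cvg_pair; [exact: cf|exact: cg]. Qed.

Lemma continuous_mulg (S : topologicalType) (f g : S -> G) :
  continuous f -> continuous g -> continuous (fun x => (f x * g x)%g).
Proof.
move=> cf cg x.
apply: (@continuous_comp _ _ _ (fun x => (f x, g x)) (fun p => (p.1 * p.2)%g)).
  exact: continuous_pair.
exact: mulg_continuous.
Qed.

Lemma continuous_invg (S : topologicalType) (f : S -> G) :
  continuous f -> continuous (fun x => (f x)^-1%g).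
Proof.
move=> cf x; apply: (@continuous_comp _ _ _ f (fun p : G => p^-1%g)); first exact: cf.
exact: invg_continuous.
Qed.

Lemma continuous_fst (S T : topologicalType) : continuous (@fst S T).
Proof. by move=> x; exact: cvg_fst. Qed.

Lemma continuous_snd (S T : topologicalType) : continuous (@snd S T).
Proof. by move=> x; exact: cvg_snd. Qed.

Lemma compact_image (S T : topologicalType) (f : S -> T) (K : set S) :
  continuous f -> compact K -> compact (f @` K).
Proof.
by move=> cf cK; apply: continuous_compact => //; exact: continuous_subspaceT.
Qed.

Lemma compact_image2 (S T V : topologicalType) (f : S * T -> V)
    (K : set S) (L : set T) : continuous f -> compact K -> compact L ->
  compact [set f (x, y) | x in K & y in L].
Proof.
move=> cf cK cL.
suff -> : [set f (x, y) | x in K & y in L] = f @` (K `*` L).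
  by apply: compact_image => //; exact: compact_setX.
apply/seteqP; split=> [_ [x Kx [y Ly <-]]|_ [[x y] [Kx Ly] <-]].
  by exists (x, y).
by exists x => //; exists y.
Qed.

Lemma continuous_identity (S : topologicalType) : continuous (fun x : S => x).
Proof. by move=> x; exact: cvg_id. Qed.

Lemma continuous_mulgl t : continuous (fun x : G => (t * x)%g).
Proof.
apply: continuous_mulg; first exact: cst_continuous.
exact: continuous_identity.
Qed.

Lemma continuous_mulgr t : continuous (fun x : G => (x * t)%g).
Proof.
apply: continuous_mulg; last exact: cst_continuous.
exact: continuous_identity.
Qed.

Lemma compact_mulgr K t : compact K -> compact [set (x * t)%g | x in K].
Proof. by apply: compact_image; exact: continuous_mulgr. Qed.

Lemma compact_FtFinv K t : compact K -> compact (FtFinv K t).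
Proof.
move=> cK; apply: (@compact_image2 _ _ _ (fun p => (p.1 * t * p.2^-1)%g)) => //.
apply: continuous_mulg; first apply: continuous_mulg.
- exact: continuous_fst.
- exact: cst_continuous.
- by apply: continuous_invg; exact: continuous_snd.
Qed.

Lemma locally_compact_between (K U : set G) : hausdorff_space G ->
  locally_compact [set: G] -> compact K -> open U -> K `<=` U ->
  exists V C, [/\ open V, compact C, K `<=` V, V `<=` C & C `<=` U].
Proof.
move=> hG lcG cK oU KU.
have [||x Kx|W KW [V [C [oV cC WV VC CU]]]] := @compact_induction G
  (fun W => exists V C, [/\ open V, compact C, W `<=` V, V `<=` C & C `<=` U]) K _ _ _ cK.
- by exists set0, set0; split => //; [exact: open0|exact: compact0].
- move=> W W' [V [C [? ? ? ? ?]]] [V' [C' [? ? ? ? ?]]].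
  exists (V `|` V'), (C `|` C'); split; [exact: openU|exact: compactU| | |].
  + exact: setUSS.
  + exact: setUSS.
  + by rewrite subUset.
- have [B] := lcG x Logic.I; rewrite /within /= => xB0 [cB clB].
  have xB : nbhs x B by apply: filterS xB0 => y; exact.
  have [|A xA AU] := @compact_regular _ x B hG cB xB (U `&` B).
    by apply: filterI => //; apply: open_nbhs_nbhs; split => //; exact: KU.
  exists A°; first exact: nbhs_interior.
  exists A°, (closure A); split => //.
  + exact: open_interior.
  + apply: (subclosed_compact _ cB); first exact: closed_closure.
    by move=> y /AU[].
  + by apply: subset_trans (@subset_closure _ _); exact: interior_subset.
  + by move=> y /AU[].
- by exists V, C; split => //; exact: subset_trans WV.
Qed.

(** A tube lemma; it yields the upper semicontinuity of the modular function. *)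
Lemma near_compact_mulg K U : compact K -> open U -> K `<=` U ->
  \forall t \near (1%g : G), [set (x * t)%g | x in K] `<=` U.
Proof.
move=> /compact_near_coveringP cK oU KU.
have : \forall t \near (1%g : G), K `<=` [set x | U (x * t)%g].
  apply: cK => x Kx.
  have := @mulg_continuous G (x, 1%g) U; rewrite /= mulg1; apply.
  by apply: open_nbhs_nbhs; split => //; exact: KU.
by apply: filterS => t h _ [x Kx <-]; exact: h.
Qed.

End TopologicalGroup.

(** * Disjointness of the translates *)

Section DisjointTranslates.
Variable G : topologicalGroupType.

Lemma folner_index_card_le (calK : set (set G)) : infinite_set calK ->
  (folner_index calK #<= calK)%card.
Proof.
move=> /card_setX_nat_le; apply: card_le_trans; apply: subset_card_le.
by move=> [K n] [].
Qed.

Lemma compact_covering_card_infinite (calK : set (set G)) :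
  ~ compact [set: G] -> has_compact_covering_card calK -> infinite_set calK.
Proof.
move=> ncG [C0 [[C0c C0G] _ eqC]] finK; apply: ncG; rewrite -C0G.
have finC0 : finite_set C0.
  by apply: card_le_finite finK; rewrite (card_le_eqr eqC).
by rewrite -bigsetU_fset_set// big_seq;
  apply: bigsetU_compact => A;
  rewrite in_fset_set// inE => /C0c.
Qed.

Lemma disjoint_translates (calK : set (set G)) (F : set G * nat -> set G) :
  ~ compact [set: G] -> has_compact_covering_card calK ->
  (forall i, folner_index calK i -> compact (F i)) ->
  exists t : set G * nat -> G,
    trivIset (folner_index calK) (fun i => FtFinv (F i) (t i)).
Proof.
move=> ncG cardK cF; have infK := compact_covering_card_infinite ncG cardK.
have [lt [wf tot small]] := well_order_card_le (folner_index_card_le infK).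
pose P i x j y := FtFinv (F i) x `&` FtFinv (F j) y = set0.
have [|t tP] := @well_founded_choice _ G lt P (folner_index calK) wf.
  move=> t i Di.
  pose J := [set j | folner_index calK j /\ lt j i].
  (* If a x b^-1, with a and b in [F i], lies in the set already built at stage [j], then x = a^-1
     (a x b^-1) b lies in [bad j]. *)
  pose bad j := [set (p.1^-1 * p.2 * b)%g |
    p in F i `*` FtFinv (F j) (t j) & b in F i].
  apply: contrapT => nx; apply: (small i Di).
  have [C0 [_ minC eqC]] := cardK.
  have cov : Defs.compact_cover (bad @` J).
    split=> [_ [j [Dj ji] <-]|].
      apply: (@compact_image2 _ _ _ (fun q => (q.1.1^-1 * q.1.2 * q.2)%g)).
      - apply: continuous_mulg; last exact: continuous_snd.
        apply: continuous_mulg; first apply: continuous_invg.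
          by move=> q; apply: continuous_comp; [exact: cvg_fst|exact: cvg_fst].
        by move=> q; apply: continuous_comp; [exact: cvg_fst|exact: cvg_snd].
      - by apply: compact_setX; [exact: cF|apply: compact_FtFinv; exact: cF].
      - exact: cF.
    apply/seteqP; split=> // x _; apply: contrapT => nbad; apply: nx; exists x.
    move=> j Dj ji; apply/seteqP; split=> // _ [[a Fa [b Fb <-]] h].
    apply: nbad; exists (bad j); first by exists j.
    exists (a, (a * x * b^-1)%g); first by split.
    by exists b => //=; rewrite !mulgA mulVg mul1g -mulgA mulVg mulg1.
  (* Minimality of [C0] bounds kappa by the size of this cover, hence by that of the initial segment
     [J]. *)
  rewrite (card_le_eql eqC); apply: card_le_trans (minC _ cov) _.
  exact: card_image_le.
exists t => i j Di Dj [x [xi xj]]; apply: contrapT => ij.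
have [h|h] := tot _ _ Di Dj ij.
  by have := tP _ _ Dj Di h; rewrite /P setIC => /seteqP[/(_ x)] /(_ (conj xi xj)).
by have := tP _ _ Di Dj h; rewrite /P => /seteqP[/(_ x)] /(_ (conj xi xj)).
Qed.

End DisjointTranslates.

(** * Borel sets and product measurability *)

Definition sigma_compact (T : topologicalType) (A : set T) :=
  exists2 K : (set T)^nat, (forall n, compact (K n)) & A = \bigcup_n K n.

Section SigmaCompact.

Lemma compact_sigma_compact (T : topologicalType) (A : set T) :
  compact A -> sigma_compact A.
Proof. by move=> cA; exists (fun=> A) => //; rewrite bigcup_const. Qed.

Lemma sigma_compact_image2 (S T V : topologicalType) (f : S * T -> V)
    (A : set S) (B : set T) : continuous f -> sigma_compact A ->
  sigma_compact B -> sigma_compact [set f (x, y) | x in A & y in B].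
Proof.
move=> cf [K cK ->] [L cL ->].
(* An enumeration of all pairs; numbers that code no pair repeat the piece (0, 0), which is harmless
   in a union. *)
pose u (n : nat) : nat * nat := odflt (0, 0)%N (unpickle n).
exists (fun n => [set f (x, y) | x in K (u n).1 & y in L (u n).2]).
  by move=> n; exact: compact_image2.
apply/seteqP; split=> [_ [x [n _ Kx] [y [m _ Ly] <-]]|_ [n _ [x Kx [y Ly <-]]]].
  exists (pickle (n, m)) => //; rewrite /u pickleK /=.
  by exists x => //; exists y.
by exists x; [exists (u n).1|exists y; [exists (u n).2|]].
Qed.

Lemma sigma_compactU (T : topologicalType) (A B : set T) :
  sigma_compact A -> sigma_compact B -> sigma_compact (A `|` B).
Proof.
move=> [K cK ->] [L cL ->]; exists (fun n => K n `|` L n).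
  by move=> n; exact: compactU.
by rewrite bigcupU.
Qed.

Lemma sigma_compact_image (S T : topologicalType) (f : S -> T) (A : set S) :
  continuous f -> sigma_compact A -> sigma_compact (f @` A).
Proof.
move=> cf [K cK ->]; exists (fun n => f @` K n).
  by move=> n; exact: compact_image.
by rewrite image_bigcup.
Qed.

Lemma sigma_compact_bigcup (T : topologicalType) (S : (set T)^nat) :
  (forall n, sigma_compact (S n)) -> sigma_compact (\bigcup_n S n).
Proof.
move=> sS; have /choice[K KP] : forall n, exists K : (set T)^nat,
    (forall m, compact (K m)) /\ S n = \bigcup_m K m.
  by move=> n; have [K cK SK] := sS n; exists K.
pose u (n : nat) : nat * nat := odflt (0, 0)%N (unpickle n).
exists (fun n => K (u n).1 (u n).2); first by move=> n; have [] := KP (u n).1.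
apply/seteqP; split=> x [n _].
  have [_ ->] := KP n => -[m _ Kx]; exists (pickle (n, m)) => //.
  by rewrite /u pickleK.
by move=> Kx; exists (u n).1 => //; have [_ ->] := KP (u n).1; exists (u n).2.
Qed.

End SigmaCompact.

Section Borel.
Variable G : topologicalGroupType.
Hypothesis hausG : hausdorff_space G.

Lemma open_borel (U : set G) : open U -> measurable (U : set (borel G)).
Proof. exact: sub_sigma_algebra. Qed.

Lemma closed_borel (A : set G) : closed A -> measurable (A : set (borel G)).
Proof.
by move=> cA; rewrite -[A]setCK; apply: measurableC; apply: open_borel;
  exact: closed_openC.
Qed.

Lemma compact_borel (A : set G) : compact A -> measurable (A : set (borel G)).
Proof. by move=> cA; apply: closed_borel; exact: compact_closed. Qed.

Lemma sigma_compact_borel (A : set G) :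
  sigma_compact A -> measurable (A : set (borel G)).
Proof.
by move=> [K cK ->]; apply: bigcup_measurable => n _; exact: compact_borel.
Qed.

Lemma continuous_borel (f : G -> G) : continuous f ->
  measurable_fun [set: borel G] (f : borel G -> borel G).
Proof.
move=> cf; apply: (@measurability _ _ (borel G) (borel G) setT f (@open G)) => //.
move=> _ [U oU <-]; rewrite setTI; apply: open_borel.
by move/continuousP : cf; exact.
Qed.

Section Composition.
Context d (T : measurableType d).
Implicit Type f : borel G -> T.

Lemma measurable_comp_continuous f (g : G -> G) : continuous g ->
  measurable_fun [set: borel G] f ->
  measurable_fun [set: borel G] (fun x : borel G => f (g x)).
Proof. by move=> cg mf; exact: measurableT_comp mf (continuous_borel cg). Qed.

Lemma measurable_comp_fst f : measurable_fun [set: borel G] f ->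
  measurable_fun [set: borel G * borel G] (fun p : borel G * borel G => f p.1).
Proof. by move=> mf; exact: measurableT_comp mf measurable_fst. Qed.

Lemma measurable_comp_snd f : measurable_fun [set: borel G] f ->
  measurable_fun [set: borel G * borel G] (fun p : borel G * borel G => f p.2).
Proof. by move=> mf; exact: measurableT_comp mf measurable_snd. Qed.

End Composition.

(** Open rectangles are product measurable, while an arbitrary open subset of the product may not
    be; finitely many rectangles inside [W] cover [C]. *)
Lemma compact_open_between_measurable (C W : set (G * G)) : compact C ->
  open W -> C `<=` W ->
  exists R, [/\ measurable (R : set (borel G * borel G)), C `<=` R & R `<=` W].
Proof.
move=> cC oW CW.
have [||x Cx|U CU [R [mR UR RW]]] := @compact_induction _
   (fun U => exists R : set (borel G * borel G),
     [/\ measurable R, U `<=` R & R `<=` W]) C _ _ _ cC.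
- by exists set0; split => //; exact: measurable0.
- move=> U V [R [mR UR RW]] [R' [mR' UR' RW']]; exists (R `|` R'); split.
  + exact: measurableU.
  + exact: setUSS.
  + by rewrite subUset.
- have [[A B] /= [xA xB] ABW] : nbhs x W by apply: open_nbhs_nbhs; split => //; exact: CW.
  exists (A° `*` B°).
    by exists (A°, B°) => //=; split; exact: nbhs_interior.
  exists (A° `*` B°); split=> //.
    by apply: measurableX; apply: open_borel; exact: open_interior.
  by move=> [y z] [/interior_subset Ay /interior_subset Bz]; exact: ABW.
- by exists R; split => //; exact: subset_trans UR.
Qed.

(* Unless [G] is second countable, a continuous [f : G * G -> G] need not be
   measurable for the product of the Borel sigma-algebras. *)
Lemma measurable_preimage_Gdelta (f : G * G -> G) (A K L : set G) :
  continuous f -> closed A -> Gdelta A -> sigma_compact K -> sigma_compact L ->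
  measurable ((K `*` L) `&` f @^-1` A : set (borel G * borel G)).
Proof.
move=> cf clA [U oU AU] [K' cK' ->] [L' cL' ->].
rewrite (_ : _ `&` _ = \bigcup_n \bigcup_m ((K' n `*` L' m) `&` f @^-1` A)); last first.
  apply/seteqP; split=> [[x y] [[[n _ Kx] [m _ Ly]] Axy]|[x y] [n _ [m _ [[/= Kx Ly] Axy]]]].
    by exists n => //; exists m.
  by split => //; split; [exists n|exists m].
apply: bigcup_measurable => n _; apply: bigcup_measurable => m _.
set C := (_ `&` _).
have cC : compact C.
  apply: compact_closedI; first exact: compact_setX.
  by move/continuous_closedP : cf; exact.
have /choice[R RP] : forall i, exists R, [/\ measurable (R : set (borel G * borel G)),
    C `<=` R & R `<=` f @^-1` U i].
  move=> i; apply: compact_open_between_measurable => //.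
    by move/continuousP : cf; exact.
  by move=> [x y] [_]; rewrite AU => /(_ i Logic.I).
(* Each [R i] is squeezed between [C] and the preimage of [U i], and the [U i] intersect in [A]. *)
rewrite (_ : C = (K' n `*` L' m) `&` \bigcap_i R i); last first.
  apply/seteqP; split=> [p Cp|p [KLp Rp]].
    by split; [case: Cp|move=> i _; have [_ + _] := RP i; exact].
  split=> //; rewrite /= AU => i _; have [_ _] := RP i; apply; exact: Rp.
apply: measurableI; first by apply: measurableX; exact: compact_borel.
by apply: bigcap_measurable => // i _; have [] := RP i.
Qed.

End Borel.

(** * Haar measure and the modular function *)

Section ModularFunction.
Context (R : realType) (G : topologicalGroupType).
Hypothesis hausG : hausdorff_space G.
Hypothesis lcG : locally_compact [set: G].
Variable mu : {measure set (borel G) -> \bar R}.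
Hypothesis haar_mu : left_haar_measure mu.
Variable Delta : G -> R.
Hypothesis modDelta : modular_function mu Delta.

Lemma mulgl_borel (t : G) :
  measurable_fun [set: borel G] ((fun x : G => (t * x)%g) : borel G -> borel G).
Proof.
apply: continuous_borel; exact: continuous_mulgl.
Qed.

Lemma mulgr_borel (t : G) :
  measurable_fun [set: borel G] ((fun x : G => (x * t)%g) : borel G -> borel G).
Proof.
apply: continuous_borel; exact: continuous_mulgr.
Qed.

Lemma invg_borel :
  measurable_fun [set: borel G] ((fun x : G => (x^-1)%g) : borel G -> borel G).
Proof. by apply: continuous_borel; exact: invg_continuous. Qed.

Lemma measure_mulgl (t : G) (A : set (borel G)) : measurable A ->
  mu [set x | A (t * (x : G))%g] = mu A.
Proof.
move=> mA; rewrite -(haar_left_invariant haar_mu t^-1%g mA); congr (mu _).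
apply/seteqP; split=> [x Ax|_ [x Ax <-]]; last by rewrite /= mulgA mulgV mul1g.
by exists (t * x)%g => //; rewrite mulgA mulVg mul1g.
Qed.

Lemma ge0_integral_mulgl (t : G) (f : borel G -> \bar R) :
  measurable_fun [set: borel G] f -> (forall x, 0 <= f x)%E ->
  (\int[mu]_x f (t * (x : G))%g = \int[mu]_x f x)%E.
Proof.
move=> mf f0.
rewrite -[LHS](@ge0_integral_pushforward _ _ _ _ _ _ (mulgl_borel t) mu setT f)//.
apply: eq_measure_integral => [|? A mA _]; first exact: mulgl_borel.
exact: measure_mulgl.
Qed.

Lemma measure_mulgr (t : G) (A : set (borel G)) : measurable A ->
  mu [set x | A ((x : G) * t)%g] = (mu A * (Delta t^-1%g)%:E)%E.
Proof.
move=> mA; rewrite -modDelta//; congr (mu _); apply/seteqP; split=> [x Ax|_ [x Ax <-]].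
  by exists (x * t)%g => //; rewrite -mulgA mulgV mulg1.
by rewrite /= -mulgA mulVg mulg1.
Qed.

Lemma compact_measure_fin_num (K : set G) : compact K -> mu K \is a fin_num.
Proof.
by move=> cK; rewrite ge0_fin_numE ?measure_ge0//; exact: haar_compact.
Qed.

(** Such a set also has finite measure, so identities for [Delta] can be read off from its
    translates by cancelling [mu K]. *)
Lemma compact_measure_gt0 : exists2 K : set G, compact K & (0 < mu K)%E.
Proof.
apply: contrapT => h; have := haar_nonzero haar_mu; apply/negP; rewrite negbK.
rewrite (haar_inner haar_mu openT); apply/eqP/le_anti/andP; split.
  apply: ge_ereal_sup => _ [K [cK _] <-]; rewrite leNgt; apply/negP => K0.
  by apply: h; exists K.
by apply: ereal_sup_ubound; exists set0; [split; [exact: compact0|]|rewrite measure0].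
Qed.

Lemma modular_function_ge0 (t : G) : 0 <= Delta t.
Proof.
have [K cK K0] := compact_measure_gt0.
have : (0 <= mu K * (Delta t)%:E)%E.
  by rewrite -modDelta; [exact: measure_ge0|exact: compact_borel].
rewrite -(fineK (compact_measure_fin_num cK)) -EFinM lee_fin pmulr_rge0//.
by rewrite -lte_fin fineK ?compact_measure_fin_num.
Qed.

Lemma modular_functionM (s t : G) : Delta (s * t)%g = Delta s * Delta t.
Proof.
have [K cK K0] := compact_measure_gt0.
have K0' : fine (mu K) != 0.
  by rewrite gt_eqF// -lte_fin fineK ?compact_measure_fin_num.
apply: (mulfI K0'); apply: EFin_inj; rewrite mulrA !EFinM fineK ?compact_measure_fin_num//.
have mK := compact_borel hausG cK.
rewrite -modDelta// -[in RHS]modDelta// -modDelta; last first.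
  apply: compact_borel => //; exact: compact_mulgr.
congr (mu _); rewrite image_comp; apply/seteqP; split=> _ [x Kx <-];
  by exists x => //=; rewrite mulgA.
Qed.

Lemma modular_function1 : Delta 1%g = 1.
Proof.
have [K cK K0] := compact_measure_gt0.
have K0' : fine (mu K) != 0.
  by rewrite gt_eqF// -lte_fin fineK ?compact_measure_fin_num.
apply: (mulfI K0'); apply: EFin_inj; rewrite mulr1 EFinM fineK ?compact_measure_fin_num//.
rewrite -modDelta; last exact: compact_borel.
by congr (mu _); apply/seteqP; split=> [_ [x Kx <-]|x Kx]; [|exists x => //]; rewrite mulg1.
Qed.

Lemma modular_functionV (t : G) : Delta t * Delta t^-1%g = 1.
Proof. by rewrite -modular_functionM mulgV modular_function1. Qed.

Lemma ge0_integral_mulgr (t : G) (f : borel G -> \bar R) :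
  measurable_fun [set: borel G] f -> (forall x, 0 <= f x)%E ->
  (\int[mu]_x f ((x : G) * t)%g = (Delta t^-1%g)%:E * \int[mu]_x f x)%E.
Proof.
move=> mf f0.
rewrite -[LHS](@ge0_integral_pushforward _ _ _ _ _ _ (mulgr_borel t) mu setT f)//.
rewrite -(@ge0_integral_mscale _ _ _ mu setT measurableT
  (NngNum (modular_function_ge0 t^-1%g)) f)//.
apply: eq_measure_integral => [|? A mA _]; first exact: mulgr_borel.
exact: etrans (measure_mulgr _ mA) (muleC _ _).
Qed.

(** By outer regularity Kt has an open neighbourhood U with |U| < |K| c. For s near t the set Ks is
    still inside U, so |K| Delta(s) <= |U|. This upper semicontinuity gives Borel measurability and
    bounds on compact sets. *)
Lemma open_modular_function_lt (c : R) : open [set t : G | Delta t < c].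
Proof.
rewrite openE => t /= tc.
have [K cK K0] := compact_measure_gt0.
have K0' : 0 < fine (mu K) by rewrite -lte_fin fineK ?compact_measure_fin_num.
have mK := compact_borel hausG cK.
have [U oU [KU KtU]] : exists2 U, open U & [set (x * t)%g | x in K] `<=` U /\
    (mu U < (fine (mu K) * c)%:E)%E.
  have cKt := compact_mulgr (t := t) cK.
  have : (mu [set (x * t)%g | x in K] < (fine (mu K) * c)%:E)%E.
    rewrite modDelta// -(fineK (compact_measure_fin_num cK)) -EFinM lte_fin.
    by rewrite ltr_pM2l.
  rewrite (haar_outer haar_mu); last exact: compact_borel.
  by move=> /ereal_inf_lt[_ [U [oU KU] <-] UK]; exists U.
have cont := @continuous_mulgl G t^-1%g.
have := near_compact_mulg (compact_mulgr (t := t) cK) oU KU.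
rewrite -(mulVg t) => /(cont t) h.
have {}h : nbhs t [set s |
  [set (x * (t^-1 * s))%g | x in [set (x * t)%g | x in K]] `<=` U] := h.
apply: filterS h => s /= sU.
rewrite -(@ltr_pM2l _ (fine (mu K)))// -lte_fin EFinM fineK ?compact_measure_fin_num//.
rewrite -modDelta//; apply: le_lt_trans KtU; apply: le_measure.
- rewrite inE; apply: compact_borel => //; exact: compact_mulgr.
- by rewrite inE; exact: open_borel.
- move=> _ [x Kx <-]; apply: sU; exists (x * t)%g; first by exists x.
  by rewrite -mulgA (mulgA t) mulgV mul1g.
Qed.

Lemma measurable_modular_function :
  measurable_fun [set: borel G] (Delta : borel G -> R).
Proof.
apply: (@measurability _ _ (borel G) _ setT Delta _ (RGenInftyO.measurableE R)) => //.
move=> _ [_ [x ->] <-]; rewrite setTI; apply: open_borel.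
rewrite (_ : _ @^-1` _ = [set t : G | Delta t < x]).
  exact: open_modular_function_lt.
by apply/seteqP; split=> t /=; rewrite in_itv.
Qed.

Lemma compact_modular_function_bounded (K : set G) : compact K ->
  exists M, forall t, K t -> Delta t <= M.
Proof.
move=> cK.
have [||x Kx|U KU [M UM]] := @compact_induction G
  (fun U => exists M, forall t, U t -> Delta t <= M) K _ _ _ cK.
- by exists 0.
- move=> U V [M UM] [N VN]; exists (Num.max M N) => t.
  by rewrite le_max => -[/UM->|/VN->]; rewrite ?orbT.
- exists [set t | Delta t < Delta x + 1].
    apply: open_nbhs_nbhs; split; first exact: open_modular_function_lt.
    by rewrite /= ltrDl.
  by exists (Delta x + 1) => t /ltW.
- by exists M => t /KU/UM.
Qed.

End ModularFunction.

(** * Tonelli's theorem on sigma-compact rectangles, and compact G_delta hulls *)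

Lemma integral_mrestr d (T : measurableType d) (R : realType)
    (mu : {measure set T -> \bar R}) (D : set T) (mD : measurable D)
    (f : T -> \bar R) : (forall x, ~ D x -> f x = 0%E) ->
  (\int[mrestr mu mD]_x f x = \int[mu]_x f x)%E.
Proof.
move=> f0; have -> : f = f \_ D.
  by apply/funext => x; rewrite patchE; case: ifPn => //; rewrite notin_setE => /f0.
rewrite -!integral_mkcond; apply: eq_measure_integral => // A mA AD.
by rewrite /= /mrestr setIidl.
Qed.

Lemma measurable_fun_off d (T : measurableType d) (R : realType)
    (D : set T) (f : T -> \bar R) : measurable D ->
  (forall x, ~ D x -> f x = 0%E) -> measurable_fun D f ->
  measurable_fun [set: T] f.
Proof.
move=> mD f0 mf; have -> : f = f \_ D.
  by apply/funext => x; rewrite patchE; case: ifPn => //; rewrite notin_setE => /f0.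
exact/(measurable_restrictT f mD).
Qed.

(** Sigma-finiteness is a hypothesis instead of a structure because the lemma is meant for
    restrictions of [mu], which are sigma-finite only for suitable sets. *)
Lemma tonelli d1 d2 (T1 : measurableType d1) (T2 : measurableType d2)
    (R : realType) (m1 : {measure set T1 -> \bar R})
    (m2 : {measure set T2 -> \bar R}) (f : T1 * T2 -> \bar R) :
  sigma_finite setT m1 -> sigma_finite setT m2 ->
  measurable_fun setT f -> (forall p, 0 <= f p)%E ->
  [/\ measurable_fun setT (fun x => \int[m2]_y f (x, y))%E,
      measurable_fun setT (fun y => \int[m1]_x f (x, y))%E &
      (\int[m1]_x \int[m2]_y f (x, y) = \int[m2]_y \int[m1]_x f (x, y))%E].
Proof.
move=> s1 s2 mf f0.
pose m1' : {sigma_finite_measure set T1 -> \bar R} :=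
  HB.pack_for (SigmaFiniteMeasure.type T1 R) (Measure.sort m1)
    (@isSFinite.Build _ _ _ m1 (sfinite_measure_sigma_finite s1))
    (@isSigmaFinite.Build _ _ _ m1 s1).
pose m2' : {sigma_finite_measure set T2 -> \bar R} :=
  HB.pack_for (SigmaFiniteMeasure.type T2 R) (Measure.sort m2)
    (@isSFinite.Build _ _ _ m2 (sfinite_measure_sigma_finite s2))
    (@isSigmaFinite.Build _ _ _ m2 s2).
split.
- exact: (@measurable_fun_fubini_tonelli_F _ _ _ _ R m2' f).
- exact: (@measurable_fun_fubini_tonelli_G _ _ _ _ R m1' f).
- exact: (@fubini_tonelli _ _ _ _ R m1' m2' f).
Qed.

Section Regularity.
Context (R : realType) (G : topologicalGroupType).
Hypothesis hausG : hausdorff_space G.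
Hypothesis lcG : locally_compact [set: G].
Variable mu : {measure set (borel G) -> \bar R}.
Hypothesis haar_mu : left_haar_measure mu.
Variable Delta : G -> R.
Hypothesis modDelta : modular_function mu Delta.

Lemma mrestr_sigma_finite (A : set (borel G)) (mA : measurable A) :
  sigma_compact (A : set G) -> sigma_finite setT (mrestr mu mA).
Proof.
(* Index 0 is spent on the complement of [A], a null set for the restricted measure, since the cover
   must exhaust the whole group. *)
move=> [K cK AK]; exists (fun n => if n is m.+1 then K m else ~` A).
  apply/esym; rewrite -subTset => x _; have [Ax|nAx] := pselect (A x).
    by move: Ax; rewrite AK => -[n _ Kx]; exists n.+1.
  by exists 0%N.
move=> [|n].
  split; first exact: measurableC.
  by rewrite /mrestr setICl measure0.
split; first exact: compact_borel.
rewrite /mrestr (le_lt_trans _ (haar_compact haar_mu (cK n)))//.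
apply: le_measure; rewrite ?inE; last exact: subIsetl.
  by apply: measurableI => //; exact: compact_borel.
exact: compact_borel.
Qed.

(** As [f] vanishes off the rectangle, [mu] may be replaced by its restrictions to [A] and [B],
    which are sigma-finite. *)
Lemma sigma_compact_tonelli (A B : set G) (f : borel G * borel G -> \bar R) :
  sigma_compact A -> sigma_compact B ->
  measurable_fun (A `*` B : set (borel G * borel G)) f ->
  (forall p, 0 <= f p)%E -> (forall p, ~ (A `*` B) p -> f p = 0%E) ->
  [/\ measurable_fun [set: borel G] (fun x => \int[mu]_y f (x, y))%E,
      measurable_fun [set: borel G] (fun y => \int[mu]_x f (x, y))%E &
      (\int[mu]_x \int[mu]_y f (x, y) = \int[mu]_y \int[mu]_x f (x, y))%E].
Proof.
move=> sA sB mf f0 fAB.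
have mA := sigma_compact_borel hausG sA.
have mB := sigma_compact_borel hausG sB.
have {}mf : measurable_fun [set: borel G * borel G] f.
  by apply: measurable_fun_off mf => //; exact: measurableX.
pose m1 : {measure set (borel G) -> \bar R} := mrestr mu mA.
pose m2 : {measure set (borel G) -> \bar R} := mrestr mu mB.
have [F_meas G_meas FG] := @tonelli _ _ (borel G) (borel G) R m1 m2 f
  (mrestr_sigma_finite mA sA) (mrestr_sigma_finite mB sB) mf f0.
have E1 x : (\int[mu]_y f (x, y) = \int[m2]_y f (x, y))%E.
  by rewrite integral_mrestr// => y nB; apply: fAB => -[].
have E2 y : (\int[mu]_x f (x, y) = \int[m1]_x f (x, y))%E.
  by rewrite integral_mrestr// => x nA; apply: fAB => -[].
split.
- rewrite (_ : (fun x => _) = (fun x => \int[m2]_y f (x, y))%E); last exact/funext.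
  exact: F_meas.
- rewrite (_ : (fun y => _) = (fun y => \int[m1]_x f (x, y))%E); last exact/funext.
  exact: G_meas.
- rewrite -(@integral_mrestr _ _ _ mu _ mA); last first.
    by move=> x nA; apply: integral0_eq => y _; apply: fAB => -[].
  rewrite -[RHS](@integral_mrestr _ _ _ mu _ mB); last first.
    by move=> y nB; apply: integral0_eq => x _; apply: fAB => -[].
  under eq_integral do rewrite E1.
  under [RHS]eq_integral do rewrite E2.
  exact: FG.
Qed.

(** The hull is the intersection of relatively compact open neighbourhoods of [F], each containing
    the closure of the next, with measures tending to that of [F]. *)
Lemma compact_Gdelta_hull (F : set G) : compact F ->
  exists F', [/\ compact F', Gdelta F', F `<=` F' & mu (F' `\` F) = 0%E].
Proof.
move=> cF; have mF := compact_borel hausG cF.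
have muF := compact_measure_fin_num haar_mu cF.
(* The conditions on [O] stand under the existential so that choice yields a function defined on all
   sets, which can then be iterated. *)
have step (O : set G) n : exists V, (open O -> F `<=` O -> [/\ open V, F `<=` V,
     closure V `<=` O, compact (closure V) & (mu V < mu F + (n.+1%:R^-1)%:E)%E]).
  have [[oO FO]|nO] := pselect (open O /\ F `<=` O); last first.
    by exists set0 => oO FO; case: nO.
  have : (mu F < mu F + (n.+1%:R^-1)%:E)%E.
    by rewrite lteDl// lte_fin invr_gt0.
  rewrite {1}(haar_outer haar_mu mF) => /ereal_inf_lt[_ [U [oU FU] <-] UF].
  have [V [C [oV cC FV VC COU]]] := locally_compact_between hausG lcG cF
    (openI oO oU) (fun x Fx => conj (FO x Fx) (FU x Fx)).
  have clVC : closure V `<=` C.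
    have /closure_id -> := compact_closed hausG cC.
    exact: closureS.
  exists V => _ _; split => //.
  - by move=> x /clVC/COU[].
  - by apply: (subclosed_compact _ cC) => //; exact: closed_closure.
  - apply: le_lt_trans UF; apply: le_measure; rewrite ?inE; [exact: open_borel..|].
    by move=> x /VC/COU[].
have /choice[next nextP] : forall q : set G * nat, exists V,
    (open q.1 -> F `<=` q.1 -> [/\ open V, F `<=` V,
     closure V `<=` q.1, compact (closure V) &
     (mu V < mu F + (q.2.+1%:R^-1)%:E)%E]) by move=> [X n]; exact: step.
pose V := fix V n := if n is m.+1 then next (V m, n) else next (setT, 0%N).
have VP n : open (V n) /\ F `<=` V n.
  elim: n => [|n [oV FV]] /=.
    by have [//|] := nextP (setT, 0%N) openT.
  by have [//|] := nextP (V n, n.+1) oV.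
have VSP n : closure (V n.+1) `<=` V n.
  by have [oV FV] := VP n; have [] := nextP (V n, n.+1) oV FV.
have cV0 : compact (closure (V 0%N)) by have [] := nextP (setT, 0%N) openT.
have muV n : (mu (V n) < mu F + (n.+1%:R^-1)%:E)%E.
  case: n => [|n]; first by have [] := nextP (setT, 0%N) openT.
  by have [oV FV] := VP n; have [] := nextP (V n, n.+1) oV FV.
pose F' := \bigcap_n V n.
(* Nesting of the closures makes the G_delta set closed as well, hence compact. *)
have F'E : F' = \bigcap_n closure (V n).
  apply/seteqP; split=> x F'x n _; first by apply: subset_closure; exact: F'x.
  by apply: VSP; exact: F'x.
have cF' : compact F'.
  apply: (subclosed_compact _ cV0).
    by rewrite F'E; apply: closed_bigI => n _; exact: closed_closure.
  by rewrite F'E => x /(_ 0%N); exact.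
have FF' : F `<=` F' by move=> x Fx n _; have [_] := VP n; exact.
have mF' := compact_borel hausG cF'.
exists F'; split => //; first by exists V => // n; have [] := VP n.
have muF'n n : (mu F' < mu F + (n.+1%:R^-1)%:E)%E.
  apply: le_lt_trans (muV n); apply: le_measure; rewrite ?inE//.
    by have [/open_borel] := VP n.
  by move=> x; exact.
rewrite measureD ?setIidr//; last exact: haar_compact.
apply/eqP; rewrite sube_eq ?add0e.
- rewrite eq_le; apply/andP; split; last by apply: le_measure; rewrite ?inE.
  apply/lee_addgt0Pr => e e0.
  have [n ne] : exists n, n.+1%:R^-1 < e.
    by exists (Num.truncn e^-1); rewrite invf_plt ?posrE// truncnS_gt.
  by apply: ltW; apply: lt_trans (muF'n n) _; rewrite lteD2lE// lte_fin.
- by rewrite ge0_fin_numE ?measure_ge0//; exact: haar_compact.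
- by rewrite fin_num_adde_defl.
Qed.

End Regularity.

(** * Haar measure under inversion *)

Section Density.
Local Open Scope ereal_scope.
Import HBNNSimple.

(** Both sides agree on indicators, hence on simple functions, and monotone convergence does the
    rest; neither measure has to be sigma-finite. *)
Lemma ge0_integral_density d (T : measurableType d) (R : realType)
    (m1 m2 : {measure set T -> \bar R}) (D : set T) (w : T -> R)
    (k : T -> \bar R) : measurable D ->
  measurable_fun D w -> (forall x, 0 <= w x)%R ->
  (forall A, measurable A -> A `<=` D -> m1 A = \int[m2]_(x in A) (w x)%:E) ->
  measurable_fun D k -> (forall x, D x -> 0 <= k x) ->
  \int[m1]_(x in D) k x = \int[m2]_(x in D) (k x * (w x)%:E).
Proof.
move=> mD mw w0 m12 mk k0; pose h := nnsfun_approx mD mk.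
have hk x : D x -> (h n x)%:E @[n --> \oo] --> k x.
  by move=> Dx; exact: cvg_nnsfun_approx.
have mhw n : measurable_fun D (fun x => (h n x)%:E * (w x)%:E).
  by apply: emeasurable_funM; apply/measurable_EFinP => //; exact/measurable_funTS.
transitivity (limn (fun n => \int[m1]_(x in D) (h n x)%:E)).
  rewrite -monotone_convergence//.
  - by apply: eq_integral => y /[!inE] yD; apply/esym/cvg_lim => //; exact: hk.
  - by move=> n; apply/measurable_EFinP/measurable_funTS.
  - by move=> n y _; rewrite lee_fin.
  - by move=> y _ m n mn; rewrite lee_fin; exact/lefP/nd_nnsfun_approx.
transitivity (limn (fun n => \int[m2]_(x in D) ((h n x)%:E * (w x)%:E))); last first.
  rewrite -monotone_convergence//.
  - apply: eq_integral => y /[!inE] yD; apply/cvg_lim => //.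
    rewrite muleC; under eq_fun do rewrite muleC.
    by apply: cvgeZl => //; exact: hk.
  - by move=> n y _; rewrite -EFinM lee_fin mulr_ge0.
  - move=> y _ m n mn; rewrite -!EFinM lee_fin ler_wpM2r//.
    exact/lefP/nd_nnsfun_approx.
congr (limn _); apply/funext => n.
under eq_integral do rewrite fimfunE -fsumEFin//.
rewrite ge0_integral_fsum//; last 2 first.
- by move=> r; exact/measurable_EFinP/measurable_funM.
- by move=> r x _; rewrite EFinM nnfun_muleindic_ge0.
under [RHS]eq_integral.
  move=> x _; rewrite fimfunE -fsumEFin// ge0_mule_fsuml; last first.
    by move=> r; rewrite EFinM nnfun_muleindic_ge0.
  over.
have mrhs r : measurable_fun D
    (fun x => (r * \1_(h n @^-1` [set r]) x)%:E * (w x)%:E).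
  apply: emeasurable_funM; last exact/measurable_EFinP.
  exact/measurable_EFinP/measurable_funM.
rewrite ge0_integral_fsum//; last first.
  move=> r x _; rewrite mule_ge0 ?(lee_fin 0 (w x))//.
  by rewrite EFinM nnfun_muleindic_ge0.
apply: eq_fsbigr => r /[!inE] -[x _ xr].
have r0 : (0 <= r)%R by rewrite -xr.
have mr : measurable (h n @^-1` [set r]) by exact: measurable_sfunP.
rewrite integralZl_indic_nnsfun// integral_indic// m12//; last exact: measurableI.
under [RHS]eq_integral do rewrite EFinM -muleA.
rewrite ge0_integralZl//; last 2 first.
- apply: emeasurable_funM; last exact/measurable_EFinP.
  exact/measurable_EFinP/measurable_indic.
- by move=> y _; rewrite mule_ge0// lee_fin.
congr (_ * _); rewrite setIC integral_mkcondr.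
by apply: eq_integral => y _; rewrite patchE indicE; case: ifPn => _;
  rewrite ?mul1e// mul0e.
Qed.

End Density.

(** * The inversion formula for compact G_delta sets *)

Section InversionGdelta.
Context (R : realType) (G : topologicalGroupType).
Hypothesis hausG : hausdorff_space G.
Hypothesis lcG : locally_compact [set: G].
Variable mu : {measure set (borel G) -> \bar R}.
Hypothesis haar_mu : left_haar_measure mu.
Variable Delta : G -> R.
Hypothesis modDelta : modular_function mu Delta.

Lemma measurable_indic_Gdelta (f : G * G -> G) (A K L : set G) :
  continuous f -> compact A -> Gdelta A -> sigma_compact K -> sigma_compact L ->
  measurable_fun (K `*` L : set (borel G * borel G))
    (fun p : borel G * borel G => \1_A (f p) : R).
Proof.
move=> cf cA GA sK sL.
have mC := measurable_preimage_Gdelta hausG cf (compact_closed hausG cA) GA sK sL.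
apply: (@eq_measurable_fun _ _ _ _ (K `*` L : set (borel G * borel G))
  (\1_((K `*` L) `&` f @^-1` A : set (borel G * borel G)) : _ -> R)).
  move=> p; rewrite inE => KLp; rewrite !indicE; congr (_%:R); congr nat_of_bool.
  by apply/idP/idP => /set_mem h; apply/mem_set; [case: h|split].
exact: measurable_indic.
Qed.

Lemma indic_borel (A : set G) : measurable (A : set (borel G)) ->
  measurable_fun [set: borel G] ((\1_A : G -> R) : borel G -> R).
Proof. by move=> mA; exact: (@measurable_indic _ (borel G) R setT A mA). Qed.

Lemma measurable_modular_functionV :
  measurable_fun [set: borel G] (fun x : borel G => Delta (x : G)^-1%g).
Proof.
exact: measurable_comp_continuous (@invg_continuous G)
  (measurable_modular_function hausG haar_mu modDelta).
Qed.

Lemma compact_image_invg (A : set G) : compact A ->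
  compact [set x | A (x^-1)%g].
Proof.
move=> cA; rewrite (_ : mkset _ = [set (x^-1)%g | x in A]).
  by apply: compact_image => //; exact: invg_continuous.
apply/seteqP; split=> [x Ax|_ [x Ax <-]]; last by rewrite /= invgK.
by exists x^-1%g => //; rewrite invgK.
Qed.

Lemma measurable_invg (A : set G) : measurable (A : set (borel G)) ->
  measurable ([set x | A (x^-1)%g] : set (borel G)).
Proof.
by move=> mA; rewrite -[X in measurable X]setTI; exact: (@invg_borel G).
Qed.

Lemma EFin_indic_ge0 (A : set G) (x : G) : (0 <= (\1_A x : R)%:E)%E.
Proof. by rewrite lee_fin. Qed.

Lemma measurable_EFin_indic (A : set G) : measurable (A : set (borel G)) ->
  measurable_fun [set: borel G] (fun x : borel G => (\1_A (x : G))%:E : \bar R).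
Proof. by move=> mA; apply/measurable_EFinP; exact: indic_borel. Qed.

Lemma integral_indic_borel (A : set G) : measurable (A : set (borel G)) ->
  (\int[mu]_x (\1_A (x : G))%:E = mu A)%E.
Proof.
by move=> mA; rewrite (@integral_indic _ (borel G) R mu setT measurableT A mA) setIT.
Qed.

(** For fixed y the left translation x -> y x turns [fdiv] into [fmul]. Integrated in y first,
    [fdiv] produces |A^-1|, whereas [fmul] produces the factor Delta(x^-1). *)
Let fdiv (A B : set G) (p : borel G * borel G) : \bar R :=
  (\1_A ((p.2 : G)^-1 * (p.1 : G))%g * \1_B (p.1 : G))%:E.

Let fmul (A B : set G) (p : borel G * borel G) : \bar R :=
  (\1_A (p.1 : G) * \1_B ((p.2 : G) * (p.1 : G))%g)%:E.

Let fmul_int (A B : set G) : measurable (A : set (borel G)) ->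
  measurable (B : set (borel G)) ->
  (\int[mu]_x \int[mu]_y fmul A B (x, y) =
    mu B * \int[mu]_(x in A) (Delta (x : G)^-1%g)%:E)%E.
Proof.
move=> mA mB.
have mw : measurable_fun [set: borel G]
    (fun x : borel G => (\1_A (x : G) * Delta (x : G)^-1%g)%:E : \bar R).
  apply/measurable_EFinP/measurable_funM; first exact: indic_borel.
  exact: measurable_modular_functionV.
have w0 (x : borel G) : (0 <= (\1_A (x : G) * Delta (x : G)^-1%g)%:E :> \bar R)%E.
  by rewrite lee_fin mulr_ge0 ?(modular_function_ge0 hausG haar_mu modDelta).
transitivity (\int[mu]_x (mu B * (\1_A (x : G) * Delta (x : G)^-1%g)%:E))%E; last first.
  rewrite (ge0_integralZl mu measurableT mw); [|by move=> *|exact: measure_ge0].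
  congr (_ * _)%E; rewrite [RHS]integral_mkcond; apply: eq_integral => x _.
  by rewrite patchE indicE; case: ifPn => _; rewrite ?mul1r ?mul0r.
apply: eq_integral => x _; rewrite /fmul /=.
under eq_integral do rewrite EFinM.
have mBx := measurable_comp_continuous (continuous_mulgr (t := x)) (measurable_EFin_indic mB).
have B0 (y : borel G) : (0 <= (\1_B (y : G) : R)%:E)%E by rewrite lee_fin.
rewrite (ge0_integralZl mu measurableT mBx);
  [|by move=> y _; exact: EFin_indic_ge0|exact: EFin_indic_ge0].
have E1 := ge0_integral_mulgr hausG haar_mu modDelta x (measurable_EFin_indic mB) B0.
rewrite [X in (_ * X)%E]E1 integral_indic_borel//.
by rewrite EFinM [in RHS]muleC muleA.
Qed.

Let fdiv_int (A B : set G) : measurable (A : set (borel G)) ->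
  measurable (B : set (borel G)) ->
  (\int[mu]_x \int[mu]_y fdiv A B (x, y) = mu B * mu [set x : G | A (x^-1)%g])%E.
Proof.
move=> mA mB.
transitivity (\int[mu]_x (mu [set x : G | A (x^-1)%g] * (\1_B (x : G))%:E))%E.
  apply: eq_integral => x _; rewrite /fdiv /=.
  under eq_integral do rewrite EFinM muleC.
  have mdiv : measurable_fun [set: borel G]
      (fun y : borel G => (\1_A ((y : G)^-1 * (x : G))%g)%:E : \bar R).
    apply: (measurable_comp_continuous _ (measurable_EFin_indic mA)).
    apply: continuous_mulg; last exact: cst_continuous.
    exact: invg_continuous.
  have A0 (y : borel G) : (0 <= (\1_A ((y : G)^-1 * (x : G))%g : R)%:E)%E.
    by rewrite lee_fin.
  rewrite (ge0_integralZl mu measurableT mdiv);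
    [|by move=> y _; exact: EFin_indic_ge0|exact: EFin_indic_ge0].
  rewrite muleC; congr (_ * _)%E.
  rewrite -(ge0_integral_mulgl haar_mu x mdiv A0).
  rewrite -(integral_indic_borel (measurable_invg mA)).
  apply: eq_integral => y _; rewrite !indicE invgM -mulgA mulVg mulg1.
  by congr (_%:R%:E); congr nat_of_bool; apply/idP/idP; rewrite !inE.
have B0 (y : borel G) : (0 <= (\1_B (y : G) : R)%:E)%E by rewrite lee_fin.
rewrite (ge0_integralZl mu measurableT (measurable_EFin_indic mB));
  [|by move=> y _; exact: EFin_indic_ge0|exact: measure_ge0].
by rewrite integral_indic_borel// muleC.
Qed.

Let fdiv_fmul (A B : set G) : measurable (A : set (borel G)) ->
  measurable (B : set (borel G)) ->
  (\int[mu]_y \int[mu]_x fdiv A B (x, y) = \int[mu]_y \int[mu]_x fmul A B (x, y))%E.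
Proof.
move=> mA mB; apply: eq_integral => y _.
have mf : measurable_fun [set: borel G] (fun x : borel G => fdiv A B (x, y)).
  apply/measurable_EFinP/measurable_funM; last exact: indic_borel.
  exact: measurable_comp_continuous (continuous_mulgl (t := y^-1%g))
    (indic_borel mA).
rewrite -(ge0_integral_mulgl haar_mu y mf); last first.
  by move=> x; rewrite lee_fin mulr_ge0.
by apply: eq_integral => x _; rewrite /fdiv /fmul /= mulgA mulVg mul1g.
Qed.

Let quot_set (A B : set G) := [set (p.1 * p.2^-1)%g | p in B `*` A].

Let sigma_compact_quot (A B : set G) : compact A -> compact B ->
  sigma_compact (quot_set A B).
Proof.
move=> cA cB; apply: compact_sigma_compact; apply: compact_image.
  apply: continuous_mulg; first exact: continuous_fst.
  by apply: continuous_invg; exact: continuous_snd.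
exact: compact_setX.
Qed.

(** The integrand lives on A x B A^-1, and only the indicator of [B] mixes the two variables; so it
    is [B] that must be a G_delta. *)
Let fmul_swap (A B : set G) : compact A -> compact B -> Gdelta B ->
  (\int[mu]_x \int[mu]_y fmul A B (x, y) = \int[mu]_y \int[mu]_x fmul A B (x, y))%E.
Proof.
move=> cA cB GB; have sA := compact_sigma_compact cA.
have sY := sigma_compact_quot cA cB.
suff [] : [/\ measurable_fun [set: borel G] (fun x => \int[mu]_y fmul A B (x, y))%E,
   measurable_fun [set: borel G] (fun y => \int[mu]_x fmul A B (x, y))%E &
   (\int[mu]_x \int[mu]_y fmul A B (x, y) = \int[mu]_y \int[mu]_x fmul A B (x, y))%E].
  by [].
apply: (sigma_compact_tonelli hausG haar_mu sA sY).
- apply/measurable_EFinP/measurable_funM.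
    apply: measurable_funTS; apply: measurable_comp_fst; apply: indic_borel.
    exact: compact_borel.
  apply: (@measurable_indic_Gdelta (fun p => (p.2 * p.1)%g)) => //.
  by apply: continuous_mulg; [exact: continuous_snd|exact: continuous_fst].
- by move=> p; rewrite lee_fin mulr_ge0.
- move=> [x y] nAY; rewrite /fmul /= !indicE.
  case: (boolP (x \in A)) => [/set_mem xA|_]; last by rewrite mul0r.
  case: (boolP ((y * x)%g \in B)) => [/set_mem xyB|_]; last by rewrite mulr0.
  exfalso; apply: nAY; split; first exact: xA.
  exists ((y * x)%g, x); first by split.
  by rewrite /= -mulgA mulgV mulg1.
Qed.

(** Here the mixed factor is the indicator of [A], and the integrand lives on B x B A^-1. *)
Let fdiv_swap (A B : set G) : compact A -> compact B -> Gdelta A ->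
  (\int[mu]_x \int[mu]_y fdiv A B (x, y) = \int[mu]_y \int[mu]_x fdiv A B (x, y))%E.
Proof.
move=> cA cB GA; have sB := compact_sigma_compact cB.
have sY := sigma_compact_quot cA cB.
suff [] : [/\ measurable_fun [set: borel G] (fun x => \int[mu]_y fdiv A B (x, y))%E,
   measurable_fun [set: borel G] (fun y => \int[mu]_x fdiv A B (x, y))%E &
   (\int[mu]_x \int[mu]_y fdiv A B (x, y) = \int[mu]_y \int[mu]_x fdiv A B (x, y))%E].
  by [].
apply: (sigma_compact_tonelli hausG haar_mu sB sY).
- apply/measurable_EFinP/measurable_funM.
    apply: (@measurable_indic_Gdelta (fun p => (p.2^-1 * p.1)%g)) => //.
    apply: continuous_mulg; last exact: continuous_fst.
    by apply: continuous_invg; exact: continuous_snd.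
  apply: measurable_funTS; apply: measurable_comp_fst; apply: indic_borel.
  exact: compact_borel.
- by move=> p; rewrite lee_fin mulr_ge0.
- move=> [x y] nAY; rewrite /fdiv /= !indicE.
  case: (boolP (x \in B)) => [/set_mem xB|_]; last by rewrite mulr0.
  case: (boolP ((y^-1 * x)%g \in A)) => [/set_mem xyA|_]; last by rewrite mul0r.
  exfalso; apply: nAY; split; first exact: xB.
  exists (x, (y^-1 * x)%g); first by split.
  by rewrite /= invgM invgK mulgA mulgV mul1g.
Qed.

(* Both sides times [mu B] are the double integral of [1_A x * 1_B (y * x)],
   computed in the two orders. *)
Lemma measure_invg_Gdelta (A : set G) : compact A -> Gdelta A ->
  (mu [set x : G | A (x^-1)%g] = \int[mu]_(x in A) (Delta (x : G)^-1%g)%:E)%E.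
Proof.
move=> cA GA; have mA := compact_borel hausG cA.
have [B [cB GB B0]] : exists B : set G, [/\ compact B, Gdelta B & (0 < mu B)%E].
  have [K cK K0] := compact_measure_gt0 haar_mu.
  have [B [cB GB KB _]] := compact_Gdelta_hull hausG lcG haar_mu cK.
  exists B; split => //; apply: lt_le_trans K0 _; apply: le_measure; rewrite ?inE//.
  - exact: compact_borel.
  - exact: compact_borel.
have mB := compact_borel hausG cB.
have Bfin := compact_measure_fin_num haar_mu cB.
have : (mu B * mu [set x : G | A (x^-1)%g] =
    mu B * \int[mu]_(x in A) (Delta (x : G)^-1%g)%:E)%E.
  by rewrite -(fmul_int mA mB) -(fdiv_int mA mB) (fdiv_swap cA cB GA)
    (fmul_swap cA cB GB) (fdiv_fmul mA mB).
have B0' : fine (mu B) != 0 by rewrite gt_eqF// fine_gt0// B0 -ge0_fin_numE.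
rewrite -(fineK Bfin) => /(congr1 (fun z => (fine (mu B))^-1%:E * z)%E).
by rewrite !muleA -EFinM mulVf// !mul1e.
Qed.

End InversionGdelta.

(** * The inversion formula for Borel subsets of sigma-compact sets *)

Section Inversion.
Context (R : realType) (G : topologicalGroupType).
Hypothesis hausG : hausdorff_space G.
Hypothesis lcG : locally_compact [set: G].
Variable mu : {measure set (borel G) -> \bar R}.
Hypothesis haar_mu : left_haar_measure mu.
Variable Delta : G -> R.
Hypothesis modDelta : modular_function mu Delta.

Lemma Gdelta_preimage (f : G -> G) (A : set G) : continuous f -> Gdelta A ->
  Gdelta (f @^-1` A).
Proof.
move=> cf [U oU ->]; exists (fun n => f @^-1` U n).
  by move=> n; move/continuousP : cf; exact.
by rewrite preimage_bigcap.
Qed.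

Lemma GdeltaI (A B : set G) : Gdelta A -> Gdelta B -> Gdelta (A `&` B).
Proof.
move=> [U oU ->] [V oV ->]; exists (fun n => U n `&` V n).
  by move=> n; exact: openI.
by rewrite bigcapI.
Qed.

Let J1 (A : set (borel G)) : \bar R := mu [set x | A ((x : G)^-1)%g].
Let J2 (A : set (borel G)) : \bar R := (\int[mu]_(x in A) (Delta (x : G)^-1%g)%:E)%E.

Let mw : measurable_fun [set: borel G]
  (fun x : borel G => (Delta (x : G)^-1%g)%:E : \bar R).
Proof.
by apply/measurable_EFinP; exact: (measurable_modular_functionV hausG haar_mu modDelta).
Qed.

Let w0 (x : borel G) : (0 <= (Delta (x : G)^-1%g)%:E)%E.
Proof. by rewrite lee_fin; exact: (modular_function_ge0 hausG haar_mu modDelta). Qed.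

Let J1_bigcup (A : (set (borel G))^nat) : (forall n, measurable (A n)) ->
  trivIset setT A -> J1 (\bigcup_n A n) = (\sum_(n <oo) J1 (A n))%E.
Proof.
move=> mA tA; rewrite /J1.
rewrite (_ : mkset _ = \bigcup_n [set x : borel G | A n ((x : G)^-1)%g]).
  rewrite measure_bigcup.
  - by apply: eq_eseriesl => i; rewrite in_setT.
  - by move=> n _; exact: measurable_invg.
  - by move=> i j _ _ [x [Ax Ay]]; apply: tA => //; exists (x : G)^-1%g.
by apply/seteqP; split=> x [n _ Ax]; exists n.
Qed.

Let J2_bigcup (A : (set (borel G))^nat) : (forall n, measurable (A n)) ->
  trivIset setT A -> J2 (\bigcup_n A n) = (\sum_(n <oo) J2 (A n))%E.
Proof.
move=> mA tA; rewrite /J2 ge0_integral_bigcup//.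
exact/measurable_funTS.
Qed.

Let J12_compact (F : set G) : compact F -> J1 F = J2 F.
Proof.
move=> cF; have [A [cA GA FA A0]] := compact_Gdelta_hull hausG lcG haar_mu cF.
have cFi := compact_image_invg cF.
have [B [cB GB FB B0]] := compact_Gdelta_hull hausG lcG haar_mu cFi.
(* Null sets are not yet known to be stable under inversion. Intersecting a hull of F with the
   inverse of a hull of F^-1 makes both C minus F and its inverse null. *)
pose C := A `&` [set x | B (x^-1)%g].
have cC : compact C.
  by apply: compact_closedI => //; apply: compact_closed => //; exact: compact_image_invg.
have GC : Gdelta C.
  by apply: GdeltaI => //; apply: Gdelta_preimage => //; exact: invg_continuous.
have FC : F `<=` C.
  by move=> x Fx; split; [exact: FA|apply: FB; rewrite /= invgK].
have mF := compact_borel hausG cF.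
have mC := compact_borel hausG cC.
have mA := compact_borel hausG cA.
have mB := compact_borel hausG cB.
have mFi := compact_borel hausG cFi.
have CF0 : mu (C `\` F) = 0%E.
  apply/eqP; rewrite eq_le measure_ge0 andbT -A0; apply: le_measure.
  - by rewrite inE; exact: measurableD.
  - by rewrite inE; exact: measurableD.
  - by move=> x [[Ax _] nFx].
have E1 : J1 F = J1 C.
  apply/eqP; rewrite eq_le; apply/andP; split.
    apply: le_measure.
    - by rewrite inE.
    - by rewrite inE; exact: measurable_invg.
    - by move=> x; exact: FC.
  pose D := [set x : G | C (x^-1)%g] `\` [set x : G | F (x^-1)%g].
  have mD : measurable (D : set (borel G)).
    by apply: measurableD => //; exact: measurable_invg.
  apply: (@le_trans _ _ (mu ([set x : G | F (x^-1)%g] `|` D))).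
    apply: le_measure.
    - by rewrite inE; exact: measurable_invg.
    - by rewrite inE; exact: measurableU.
    - by move=> x Cx; have [Fx|nFx] := pselect (F (x^-1)%g); [left|right].
  apply: le_trans (measureU2 mu mFi mD) _.
  rewrite [X in (_ + X)%E](_ : _ = 0%E) ?adde0//.
  apply/eqP; rewrite eq_le measure_ge0 andbT -B0; apply: le_measure.
  - by rewrite inE; apply: measurableD => //; exact: measurable_invg.
  - by rewrite inE; exact: measurableD.
  - by move=> x [[_ Bx] nFx]; split => //; move: Bx; rewrite /= invgK.
have E2 : J2 F = J2 C.
  rewrite /J2 [RHS](ge0_negligible_integral _ _ _ _ CF0).
  - by congr (integral _ _ _); rewrite setDD setIidr.
  - exact: measurableD.
  - exact: mC.
  - exact: measurable_funTS.
  - by move=> x _; exact: w0.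
rewrite E1 E2; exact: (measure_invg_Gdelta hausG lcG haar_mu modDelta cC GC).
Qed.

(** Inside a compact [L] both sides are finite, so the sets satisfying the formula form a Dynkin
    system. It contains the open sets because [L] minus an open set is compact. *)
Let J12_compact_borel (L : set G) (A : set (borel G)) : compact L ->
  measurable A -> J1 (L `&` A) = J2 (L `&` A).
Proof.
move=> cL; have mL := compact_borel hausG cL.
have cLi := compact_image_invg cL.
have J1D (S : set (borel G)) : measurable S ->
    J1 (L `&` ~` S) = (J1 L - J1 (L `&` S))%E.
  move=> mS; rewrite -setDE /J1 -measureD.
  - by [].
  - exact: measurable_invg.
  - exact: measurable_invg mS.
  - exact: (haar_compact haar_mu cLi).
have J2D (S : set (borel G)) : measurable S ->
    J2 (L `&` ~` S) = (J2 L - J2 (L `&` S))%E.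
  move=> mS; have -> : J2 L = (J2 (L `&` ~` S) + J2 (L `&` S))%E.
    rewrite /J2 -ge0_integral_setU.
    - by rewrite -setIUr setvU setIT.
    - by apply: measurableI => //; exact: measurableC.
    - exact: measurableI.
    - exact: measurable_funTS.
    - by move=> x _; exact: w0.
    - by apply/disj_setPS => x [[_ nS] [_ Sx]]; apply: nS.
  rewrite addeK// ge0_fin_numE; last by apply: integral_ge0 => x _; exact: w0.
  (* Finiteness of [J2 L] comes from its equality with [J1 L], the measure of a compact set. *)
  have : (J2 L < +oo)%E.
    by rewrite -J12_compact//; exact: (haar_compact haar_mu cLi).
  apply: le_lt_trans; apply: ge0_subset_integral.
  - exact: measurableI.
  - exact: mL.
  - exact: measurable_funTS.
  - by move=> x _; exact: w0.
  - by move=> x [].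
have J12C (S : set (borel G)) : measurable S -> J1 (L `&` S) = J2 (L `&` S) ->
    J1 (L `&` ~` S) = J2 (L `&` ~` S).
  by move=> mS JS; rewrite J1D// J2D// JS J12_compact.
have mE : @measurable _ (borel G) = <<s @open G >> by [].
have openI2 : setI_closed (@open G) by move=> U V; exact: openI.
apply: (@dynkin_induction _ (borel G) (@open G)
  (fun S => J1 (L `&` S) = J2 (L `&` S)) mE openI2).
- by rewrite setIT; exact: J12_compact.
- move=> U oU; rewrite -[U]setCK; apply: J12C; first by apply: measurableC; exact: open_borel.
  by apply: J12_compact; apply: compact_closedI => //; exact: open_closedC.
- exact: J12C.
- move=> S mS tS JS; rewrite setI_bigcupr J1_bigcup ?J2_bigcup.
  + by apply: eq_eseriesr => n _; exact: JS.
  + by move=> n; exact: measurableI.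
  + by apply: trivIset_setIl.
  + by move=> n; exact: measurableI.
  + by apply: trivIset_setIl.
Qed.

Lemma measure_invg (B : set G) (A : set (borel G)) : sigma_compact B ->
  measurable A -> A `<=` B ->
  (mu [set x | A ((x : G)^-1)%g] = \int[mu]_(x in A) (Delta (x : G)^-1%g)%:E)%E.
Proof.
move=> [K cK BK] mA AB; rewrite -/(J1 A) -/(J2 A).
have mK n : measurable (K n : set (borel G)) by exact: compact_borel.
have mD n : measurable (seqDU K n : set (borel G)).
  apply: measurableD => //; exact: bigsetU_measurable.
have -> : A = \bigcup_n (A `&` seqDU K n).
  by rewrite -setI_bigcupr -seqDU_bigcup_eq -BK setIidl.
have tD : trivIset setT (fun n => A `&` seqDU K n).
  by apply: trivIset_setIl; exact: trivIset_seqDU.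
have mAD n : measurable (A `&` seqDU K n) by exact: measurableI.
rewrite J1_bigcup ?J2_bigcup//; apply: eq_eseriesr => n _.
rewrite (_ : A `&` seqDU K n = K n `&` (A `&` seqDU K n)).
  exact: J12_compact_borel.
by apply/seteqP; split=> [x [Ax Kx]|x []//]; split => //; case: Kx.
Qed.

Lemma ge0_integral_invg (B : set G) (k : borel G -> \bar R) : sigma_compact B ->
  measurable_fun [set: borel G] k -> (forall x, 0 <= k x)%E ->
  (forall x, ~ B x -> k x = 0%E) ->
  (\int[mu]_x (k ((x : G)^-1)%g * (Delta (x : G)^-1%g)%:E) = \int[mu]_x k x)%E.
Proof.
move=> sB mk k0 kB; have mB := sigma_compact_borel hausG sB.
(* The left side is the integral of [h] against the image of [mu] under inversion. On [B] this image
   has density Delta(x^-1), which cancels the factor Delta(x) of [h]. *)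
pose h (x : borel G) : \bar R := (k x * (Delta x)%:E)%E.
have mD : measurable_fun [set: borel G] (fun x : borel G => (Delta x)%:E : \bar R).
  by apply/measurable_EFinP; exact: (measurable_modular_function hausG haar_mu modDelta).
have mh : measurable_fun [set: borel G] h by exact: emeasurable_funM.
have h0 x : (0 <= h x)%E.
  by rewrite mule_ge0// lee_fin (modular_function_ge0 hausG haar_mu modDelta).
have minv := @invg_borel G.
rewrite -[LHS](@ge0_integral_pushforward _ _ (borel G) (borel G) R _ minv mu setT h)//.
have hB : h = h \_ B.
  apply/funext => x; rewrite patchE; case: ifPn => //.
  by rewrite notin_setE /h => /kB ->; rewrite mul0e.
have kBE : k = k \_ B.
  by apply/funext => x; rewrite patchE; case: ifPn => //; rewrite notin_setE => /kB.
rewrite [in RHS]kBE hB -!integral_mkcond.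
have mwB : measurable_fun (B : set (borel G)) (fun x : borel G => Delta (x : G)^-1%g).
  by apply: measurable_funTS; exact: (measurable_modular_functionV hausG haar_mu modDelta).
apply: etrans (ge0_integral_density mB mwB _ _ _ _) _.
- by move=> x; exact: (modular_function_ge0 hausG haar_mu modDelta).
- by move=> A mA AB; exact: measure_invg sB mA AB.
- exact: measurable_funTS.
- by move=> x _; exact: h0.
- apply: eq_integral => x _; rewrite /h -muleA -EFinM.
  by rewrite (modular_functionV hausG haar_mu modDelta) mule1.
Qed.

End Inversion.

(** * Convolution *)

Section Convolution.
Context (R : realType) (G : topologicalGroupType).
Hypothesis hausG : hausdorff_space G.
Hypothesis lcG : locally_compact [set: G].
Variable mu : {measure set (borel G) -> \bar R}.
Hypothesis haar_mu : left_haar_measure mu.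
Variable Delta : G -> R.
Hypothesis modDelta : modular_function mu Delta.

(* The joint measurability is what Tonelli's theorem needs; it may fail for a
   Borel function on a group that is not second countable. *)
Record conv_density (f : G -> R) : Prop := {
  conv_density_ge0 : forall x, 0 <= f x ;
  conv_density_bounded : exists M, forall x, f x <= M ;
  conv_density_supp : exists2 C, compact C & forall x, ~ C x -> f x = 0 ;
  conv_density_measurable : measurable_fun [set: borel G] (f : borel G -> R) ;
  conv_density_joint : forall K L : set G, sigma_compact K -> sigma_compact L ->
    measurable_fun (K `*` L : set (borel G * borel G))
      (fun p : borel G * borel G => f ((p.1 : G)^-1 * (p.2 : G))%g) ;
  conv_density_integral : (\int[mu]_x (f (x : G))%:E = 1)%E
}.

Lemma sigma_compact_mul (A B : set G) : sigma_compact A -> sigma_compact B ->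
  sigma_compact [set (x * y)%g | x in A & y in B].
Proof.
by apply: (@sigma_compact_image2 _ _ _ (fun p => (p.1 * p.2)%g)); exact: mulg_continuous.
Qed.

Section Conv.
Variables (r : G -> R) (C : set G).
Hypothesis dr : conv_density r.
Hypothesis cC : compact C.
Hypothesis rC : forall x, ~ C x -> r x = 0.
Variables (A : set G) (u : borel G -> \bar R).
Hypothesis sA : sigma_compact A.
Hypothesis mu_ : measurable_fun [set: borel G] u.
Hypothesis u0 : forall x, (0 <= u x)%E.
Hypothesis uA : forall x, ~ A x -> u x = 0%E.

Let f (p : borel G * borel G) : \bar R :=
  (u p.1 * (r ((p.1 : G)^-1 * (p.2 : G))%g)%:E)%E.

(** Tonelli and left invariance give the convolution of [u] with [r] the integral of [u] times that
    of [r], and the latter is 1. Extended values of [u] are allowed because [u] will also be an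
    integral not known to be finite. *)
Lemma ge0_conv_tonelli :
  [/\ measurable_fun [set: borel G]
       (fun x : borel G => \int[mu]_y (u y * (r ((y : G)^-1 * (x : G))%g)%:E))%E,
     forall x : G, ~ [set (x * y)%g | x in A & y in C] x ->
       (\int[mu]_y (u y * (r ((y : G)^-1 * (x : G))%g)%:E) = 0)%E &
    (\int[mu]_x \int[mu]_y (u y * (r ((y : G)^-1 * (x : G))%g)%:E) =
     \int[mu]_x u x)%E].
Proof.
have sC := compact_sigma_compact cC.
have r0 := conv_density_ge0 dr.
have fAC p : ~ (A `*` [set (x * y)%g | x in A & y in C]) p -> f p = 0%E.
  move=> nAC; rewrite /f; have [Ap|nAp] := pselect (A p.1); last first.
    by rewrite uA// mul0e.
  rewrite rC ?mule0// => Cp; apply: nAC; split; first exact: Ap.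
  by exists p.1 => //; exists (p.1^-1 * p.2)%g => //; rewrite mulgA mulgV mul1g.
have [_ mf2 fE] : [/\ measurable_fun [set: borel G] (fun x => \int[mu]_y f (x, y))%E,
   measurable_fun [set: borel G] (fun y => \int[mu]_x f (x, y))%E &
   (\int[mu]_x \int[mu]_y f (x, y) = \int[mu]_y \int[mu]_x f (x, y))%E].
  apply: (sigma_compact_tonelli hausG haar_mu sA (sigma_compact_mul sA sC)).
  - apply: emeasurable_funM.
      by apply: measurable_funTS; exact: measurable_comp_fst.
    by apply/measurable_EFinP; apply: (conv_density_joint dr) => //; exact: sigma_compact_mul.
  - by move=> p; rewrite mule_ge0// lee_fin.
  - exact: fAC.
split; first exact: mf2.
- move=> x nx; apply: integral0_eq => y _.
  by apply: (fAC (y, x)) => -[].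
- rewrite -fE; apply: eq_integral => x _; rewrite /f /=.
  have mr : measurable_fun [set: borel G] (fun y : borel G => (r (y : G))%:E : \bar R).
    by apply/measurable_EFinP; exact: (conv_density_measurable dr).
  have mrx : measurable_fun [set: borel G]
      (fun y : borel G => (r ((x : G)^-1 * (y : G))%g)%:E : \bar R).
    exact: measurable_comp_continuous (continuous_mulgl (t := (x : G)^-1%g)) mr.
  rewrite (ge0_integralZl mu measurableT mrx).
  + rewrite [X in (_ * X)%E](ge0_integral_mulgl haar_mu (x : G)^-1%g mr).
      by rewrite (conv_density_integral dr) mule1.
    by move=> y; rewrite lee_fin.
  + by move=> y _; rewrite lee_fin.
  + exact: u0.
Qed.

End Conv.

Section ConvDensity.
Variables (f r : G -> R).
Hypothesis df : conv_density f.
Hypothesis dr : conv_density r.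

Lemma conv_density_integrand (x : G) :
  measurable_fun [set: borel G]
    (fun y : borel G => (f (y : G) * r ((y : G)^-1 * x)%g)%R).
Proof.
apply: measurable_funM; first exact: (conv_density_measurable df).
apply: (measurable_comp_continuous _ (conv_density_measurable dr)).
apply: continuous_mulg; last exact: cst_continuous.
exact: invg_continuous.
Qed.

Let f_ge0 := conv_density_ge0 df.
Let r_ge0 := conv_density_ge0 dr.

Let integral_convol_bounded : exists M, forall x : G,
  (\int[mu]_y (f (y : G) * r ((y : G)^-1 * x)%g)%:E <= M%:E)%E.
Proof.
have [M rM] := conv_density_bounded dr.
have M0 : 0 <= M by exact: le_trans (r_ge0 1%g) (rM 1%g).
have mf : measurable_fun [set: borel G] (fun y : borel G => (f (y : G))%:E : \bar R).
  by apply/measurable_EFinP; exact: (conv_density_measurable df).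
exists M => x; apply: (@le_trans _ _ (\int[mu]_y (M%:E * (f (y : G))%:E))%E).
  apply: ge0_le_integral => //.
  - by move=> y _; rewrite lee_fin mulr_ge0.
  - by apply/measurable_EFinP; exact: conv_density_integrand.
  - by apply: emeasurable_funM => //; exact: measurable_cst.
  - by move=> y _; rewrite -EFinM lee_fin mulrC ler_wpM2r.
rewrite (ge0_integralZl mu measurableT mf).
- by rewrite (conv_density_integral df) mule1.
- by move=> y _; rewrite lee_fin.
- by rewrite lee_fin.
Qed.

(** A real-valued integral sends an infinite one to 0; boundedness of [r] excludes that case. *)
Lemma convolE (x : G) : (convol mu f r x)%:E =
  (\int[mu]_y (f (y : G) * r ((y : G)^-1 * x)%g)%:E)%E.
Proof.
have [M fM] := integral_convol_bounded.
rewrite /convol /Rintegral fineK// ge0_fin_numE.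
  exact: le_lt_trans (fM x) (ltry _).
by apply: integral_ge0 => y _; rewrite lee_fin mulr_ge0.
Qed.

Lemma convol_ge0 (x : G) : 0 <= convol mu f r x.
Proof.
by rewrite -lee_fin convolE; apply: integral_ge0 => y _; rewrite lee_fin mulr_ge0.
Qed.

Lemma convol_bounded : exists M, forall x, convol mu f r x <= M.
Proof.
by have [M fM] := integral_convol_bounded; exists M => x; rewrite -lee_fin convolE.
Qed.

Lemma convol_density :
  [/\ measurable_fun [set: borel G] (convol mu f r : borel G -> R),
      (\int[mu]_x (convol mu f r (x : G))%:E = 1)%E &
      exists2 C, compact C & forall x, ~ C x -> convol mu f r x = 0].
Proof.
have [Cf cCf fCf] := conv_density_supp df.
have [Cr cCr rCr] := conv_density_supp dr.
have mf : measurable_fun [set: borel G] (fun y : borel G => (f (y : G))%:E : \bar R).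
  by apply/measurable_EFinP; exact: (conv_density_measurable df).
have f0 (x : borel G) : (0 <= (f x)%:E)%E by rewrite lee_fin; exact: (conv_density_ge0 df).
have fC0 (x : borel G) : ~ Cf x -> (f x)%:E = 0%E by move=> /fCf ->.
have [mE E0 E1] := ge0_conv_tonelli dr cCr rCr (compact_sigma_compact cCf) mf f0 fC0.
split.
- apply/measurable_EFinP.
  rewrite (_ : EFin \o _ = fun x : borel G =>
    (\int[mu]_y ((f (y : G))%:E * (r ((y : G)^-1 * (x : G))%g)%:E))%E) //.
  by apply/funext => x /=; rewrite convolE.
- under eq_integral do rewrite convolE.
  under eq_integral do under eq_integral do rewrite EFinM.
  by rewrite E1 (conv_density_integral df).
- exists [set (x * y)%g | x in Cf & y in Cr].
    apply: (@compact_image2 _ _ _ (fun p => (p.1 * p.2)%g)) => //.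
    exact: mulg_continuous.
  move=> x nx; apply: EFin_inj; rewrite convolE.
  by under eq_integral do rewrite EFinM; exact: E0.
Qed.

Lemma convol_P1 : P1 mu (convol mu f r).
Proof.
have [m i _] := convol_density.
have N : L1norm mu (convol mu f r) = 1%E.
  rewrite /L1norm Lnorm1 -i; apply: eq_integral => x _ /=.
  by rewrite ger0_norm// convol_ge0.
split => //.
- rewrite /L1 /= inE; apply/andP; split; first by rewrite inE.
  have : (L1norm mu (convol mu f r) < +oo)%E by rewrite N; exact: ltry.
  by rewrite inE.
- by apply: aeW => x; exact: convol_ge0.
Qed.

End ConvDensity.

End Convolution.

(** * The left translation estimate for a convolution *)

Lemma Rintegral_dist_le d (T : measurableType d) (R : realType)
    (mu : {measure set T -> \bar R}) (u v : T -> R) :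
  mu.-integrable setT (EFin \o u) -> mu.-integrable setT (EFin \o v) ->
  (`|\int[mu]_x u x - \int[mu]_x v x|%:E <= \int[mu]_x `|u x - v x|%:E)%E.
Proof.
move=> iu iv; rewrite -RintegralB//.
have iuv : mu.-integrable setT (EFin \o (fun x => u x - v x)).
  by have := integrableB measurableT iu iv; apply: eq_integrable.
rewrite /Rintegral -abse_EFin fineK; last exact: integrable_fin_num.
by apply: le_abse_integral => //; exact: measurable_int iuv.
Qed.

Lemma ge0_integrable_le d (T : measurableType d) (R : realType)
    (mu : {measure set T -> \bar R}) (u v : T -> R) :
  measurable_fun [set: T] u -> (forall x, 0 <= u x <= v x) ->
  mu.-integrable setT (EFin \o v) -> mu.-integrable setT (EFin \o u).
Proof.
move=> mu' uv iv; apply: le_integrable iv => //; first exact/measurable_EFinP.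
move=> x _ /=; have /andP[u0 uvx] := uv x.
by rewrite lee_fin !ger0_norm// (le_trans u0).
Qed.

Lemma ge0_integrable_EFin d (T : measurableType d) (R : realType)
    (mu : {measure set T -> \bar R}) (u : T -> R) (c : R) :
  measurable_fun [set: T] u -> (forall x, 0 <= u x) ->
  (\int[mu]_x (u x)%:E = c%:E)%E -> mu.-integrable setT (EFin \o u).
Proof.
move=> mu' u0 uc; apply/integrableP; split; first exact/measurable_EFinP.
under eq_integral do rewrite /= ger0_norm//.
by rewrite uc ltry.
Qed.

Section LeftEstimate.
Context (R : realType) (G : topologicalGroupType).
Hypothesis hausG : hausdorff_space G.
Variable mu : {measure set (borel G) -> \bar R}.
Hypothesis haar_mu : left_haar_measure mu.
Variables (f r : G -> R).
Hypothesis df : conv_density mu f.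
Hypothesis dr : conv_density mu r.
Variables (g : G -> R) (S : set G).
Hypothesis g0 : forall x, 0 <= g x.
Hypothesis mg : measurable_fun [set: borel G] (g : borel G -> R).
Hypothesis ig : (\int[mu]_x (g (x : G))%:E = 1)%E.
Hypothesis sS : sigma_compact S.
Hypothesis gS : forall x, ~ S x -> g x = 0.

Let phi := convol mu f r.

(** This dominates |g * f - f| at z. The estimate is |g * phi - phi| <= a * r pointwise, and a * r
    has the same integral as a. *)
Let a (z : borel G) : \bar R :=
  (\int[mu]_y (g (y : G) * `|f ((y : G)^-1 * (z : G))%g - f (z : G)|)%:E)%E.

(** The weight [w] is 1 for the total integral of [a], and z -> r(z^-1 x) for the pointwise
    bound. *)
Let a_tonelli (w : borel G -> R) (A : set G) : (forall x, 0 <= w x) ->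
  sigma_compact A -> (forall y z, S y -> ~ A z -> f (y^-1 * z)%g = 0 /\ f z = 0) ->
  measurable_fun [set: borel G] w ->
  [/\ measurable_fun [set: borel G] (fun y : borel G => \int[mu]_z
      (g (y : G) * `|f ((y : G)^-1 * (z : G))%g - f (z : G)| * w z)%:E)%E,
   measurable_fun [set: borel G] (fun z : borel G => \int[mu]_y
      (g (y : G) * `|f ((y : G)^-1 * (z : G))%g - f (z : G)| * w z)%:E)%E,
   (forall z, ~ A z -> \int[mu]_y
      (g (y : G) * `|f ((y : G)^-1 * (z : G))%g - f (z : G)| * w z)%:E = 0)%E &
   (\int[mu]_y \int[mu]_z
      (g (y : G) * `|f ((y : G)^-1 * (z : G))%g - f (z : G)| * w z)%:E =
    \int[mu]_z \int[mu]_y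
      (g (y : G) * `|f ((y : G)^-1 * (z : G))%g - f (z : G)| * w z)%:E)%E].
Proof.
move=> w0 sA fA mw.
pose h (p : borel G * borel G) : \bar R :=
  (g (p.1 : G) * `|f ((p.1 : G)^-1 * (p.2 : G))%g - f (p.2 : G)| * w p.2)%:E.
have hSA p : ~ (S `*` A) p -> h p = 0%E.
  move=> nSA; rewrite /h; have [Sp|nSp] := pselect (S p.1); last first.
    by rewrite gS// !mul0r.
  have [-> ->] : f ((p.1 : G)^-1 * (p.2 : G))%g = 0 /\ f (p.2 : G) = 0.
    by apply: fA => // Ap; exact: nSA.
  by rewrite subr0 normr0 mulr0 mul0r.
have [m1 m2 E] : [/\ measurable_fun [set: borel G] (fun x => \int[mu]_y h (x, y))%E,
   measurable_fun [set: borel G] (fun y => \int[mu]_x h (x, y))%E &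
   (\int[mu]_x \int[mu]_y h (x, y) = \int[mu]_y \int[mu]_x h (x, y))%E].
  apply: (sigma_compact_tonelli hausG haar_mu sS sA) => //.
  - apply/measurable_EFinP; apply: measurable_funM; last first.
      by apply: measurable_funTS; exact: measurable_comp_snd.
    apply: measurable_funM.
      by apply: measurable_funTS; exact: measurable_comp_fst.
    apply: measurableT_comp; first exact: normr_measurable.
    apply: measurable_funB; first exact: (conv_density_joint df).
    apply: measurable_funTS; apply: (@measurable_comp_snd G _ R).
    exact: (conv_density_measurable df).
  - by move=> p; rewrite lee_fin !mulr_ge0.
split => //.
by move=> z nz; apply: integral0_eq => y _; apply: (hSA (y, z)) => -[].
Qed.

Let norm_tonelli : exists2 A, sigma_compact A &
  forall y z, S y -> ~ A z -> f (y^-1 * z)%g = 0 /\ f z = 0.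
Proof.
have [C cC fC] := conv_density_supp df; have sC := compact_sigma_compact cC.
exists ([set (x * y)%g | x in S & y in C] `|` C).
  by apply: sigma_compactU => //; exact: sigma_compact_mul.
move=> y z Sy nz; split; apply: fC => Cz; apply: nz; [left|by right].
by exists y => //; exists (y^-1 * z)%g => //; rewrite mulgA mulgV mul1g.
Qed.

(** Left translation of a convolution acts on its first factor. *)
Let phi_shift (y x : G) : (phi (y^-1 * x)%g)%:E =
  (\int[mu]_z (f (y^-1 * (z : G))%g * r ((z : G)^-1 * x)%g)%:E)%E.
Proof.
rewrite /phi (convolE df dr).
have m := conv_density_integrand df dr (y^-1 * x)%g.
move/measurable_EFinP in m.
rewrite -(ge0_integral_mulgl haar_mu y^-1%g m).
  apply: eq_integral => z _ /=; congr (_ * r _)%:E.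
  by rewrite invgM invgK mulgA -(mulgA _ y) mulgV mulg1.
by move=> z; rewrite lee_fin mulr_ge0// ?(conv_density_ge0 df) ?(conv_density_ge0 dr).
Qed.

Let mf_shift (y x : G) : measurable_fun [set: borel G]
  (fun z : borel G => f (y^-1 * (z : G))%g * r ((z : G)^-1 * x)%g).
Proof.
apply: measurable_funM.
  exact: (measurable_comp_continuous (continuous_mulgl (t := y^-1%g))
    (conv_density_measurable df)).
apply: (measurable_comp_continuous _ (conv_density_measurable dr)).
apply: continuous_mulg; last exact: cst_continuous.
exact: invg_continuous.
Qed.

Let phi_dist (y x : G) : (`|phi (y^-1 * x)%g - phi x|%:E <=
  \int[mu]_z (`|f (y^-1 * (z : G))%g - f (z : G)| * r ((z : G)^-1 * x)%g)%:E)%E.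
Proof.
have f0 := conv_density_ge0 df; have r0 := conv_density_ge0 dr.
have E1 := phi_shift y x.
have E2 := convolE df dr x.
have m1 := mf_shift y x.
have m2 := conv_density_integrand df dr x.
have i1 := ge0_integrable_EFin m1 (fun z => mulr_ge0 (f0 _) (r0 _)) (esym E1).
have i2 := ge0_integrable_EFin m2 (fun z => mulr_ge0 (f0 _) (r0 _)) (esym E2).
have -> : phi (y^-1 * x)%g = \int[mu]_z (f (y^-1 * (z : G))%g * r ((z : G)^-1 * x)%g).
  by rewrite /Rintegral -E1.
apply: le_trans (Rintegral_dist_le i1 i2) _.
rewrite le_eqVlt; apply/orP; left; apply/eqP; apply: eq_integral => z _.
by rewrite -mulrBl normrM (ger0_norm (r0 _)).
Qed.

Let m_shift (x : G) : measurable_fun [set: borel G]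
  (fun y : borel G => phi ((y : G)^-1 * x)%g).
Proof.
have [m _ _] := convol_density hausG haar_mu df dr.
apply: (measurable_comp_continuous _ m).
apply: continuous_mulg; last exact: cst_continuous.
exact: invg_continuous.
Qed.

Let g_integrable : mu.-integrable [set: borel G] (EFin \o (g : borel G -> R)).
Proof. exact: ge0_integrable_EFin mg g0 ig. Qed.

Let gM_integrable (u : borel G -> R) (M : R) : measurable_fun [set: borel G] u ->
  (forall y, 0 <= u y <= M) ->
  mu.-integrable [set: borel G] (EFin \o (fun y : borel G => g y * u y)).
Proof.
move=> mu' uM; apply: (@ge0_integrable_le _ _ _ _ _ (fun y : borel G => M * g y)).
- exact: measurable_funM.
- move=> y; have /andP[u0 uM'] := uM y; rewrite mulr_ge0//= mulrC.
  by rewrite ler_wpM2r.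
- by have := integrableZl measurableT M g_integrable; apply: eq_integrable.
Qed.

Let a_off : exists2 A, sigma_compact A & forall z, ~ A z -> a z = 0%E.
Proof.
have [A sA fA] := norm_tonelli; exists A => // z nz.
apply: integral0_eq => y _.
have [Sy|nSy] := pselect (S y); last by rewrite gS// mul0r.
by have [-> ->] := fA y z Sy nz; rewrite subr0 normr0 mulr0.
Qed.

Let measurable_a : measurable_fun [set: borel G] a.
Proof.
have [A sA fA] := norm_tonelli.
have [_ m _ _] := a_tonelli (fun=> ler01) sA fA (measurable_cst _).
by move: m; under eq_fun do under eq_integral do rewrite mulr1.
Qed.

Let a_ge0 z : (0 <= a z)%E.
Proof. by apply: integral_ge0 => y _; rewrite lee_fin mulr_ge0. Qed.

Let integral_a : (\int[mu]_z a z =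
  \int[mu]_y ((g (y : G))%:E * L1norm mu (ltrans (y : G) f \- f)%R))%E.
Proof.
have [A sA fA] := norm_tonelli.
have [_ _ _ E] := a_tonelli (fun=> ler01) sA fA (measurable_cst _).
transitivity (\int[mu]_z \int[mu]_y
    (g (y : G) * `|f ((y : G)^-1 * (z : G))%g - f (z : G)| * 1)%:E)%E.
  by apply: eq_integral => z _; apply: eq_integral => y _; rewrite mulr1.
rewrite -E; apply: eq_integral => y _.
under eq_integral do rewrite mulr1 EFinM.
rewrite /L1norm Lnorm1 -ge0_integralZl.
- by [].
- exact: measurableT.
- apply/measurable_EFinP; apply: measurableT_comp; first exact: normr_measurable.
  apply: measurable_funB; last exact: (conv_density_measurable df).
  exact: (measurable_comp_continuous (continuous_mulgl (t := (y : G)^-1%g))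
    (conv_density_measurable df)).
- by move=> z _; rewrite lee_fin.
- by rewrite lee_fin.
Qed.

Let k (x : borel G) : \bar R :=
  (\int[mu]_z (a z * (r ((z : G)^-1 * (x : G))%g)%:E))%E.

Let convol_dist_le (x : G) : (`|convol mu g phi x - phi x|%:E <= k x)%E.
Proof.
have r0 := conv_density_ge0 dr.
have phi0 := convol_ge0 df dr.
have [M phiM] := convol_bounded df dr.
have i1 : mu.-integrable [set: borel G]
    (EFin \o (fun y : borel G => g y * phi ((y : G)^-1 * x)%g)).
  by apply: (gM_integrable (M := M)) => // y; rewrite phi0 phiM.
have i2 : mu.-integrable [set: borel G] (EFin \o (fun y : borel G => g y * phi x)).
  apply: (gM_integrable (u := fun=> phi x) (M := M)); first exact: measurable_cst.
  by move=> y; rewrite phi0 phiM.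
(* Since [g] has integral 1, [phi x] is an average of a constant, and the difference becomes a
   single integral against [g]. *)
have phiE : \int[mu]_y (g (y : G) * phi x) = phi x.
  rewrite (RintegralZr _ measurableT g_integrable).
  by rewrite /Rintegral ig mul1r.
rewrite -[X in _ - X]phiE.
apply: le_trans (Rintegral_dist_le i1 i2) _.
have [A sA fA] := norm_tonelli.
have mrx : measurable_fun [set: borel G] (fun z : borel G => r ((z : G)^-1 * x)%g).
  apply: (measurable_comp_continuous _ (conv_density_measurable dr)).
  apply: continuous_mulg; last exact: cst_continuous.
  exact: invg_continuous.
have [m1 m2 _ E] := a_tonelli (w := fun z : borel G => r ((z : G)^-1 * x)%g)
  (fun z => r0 _) sA fA mrx.
rewrite [leRHS](_ : _ = \int[mu]_y \int[mu]_z
    (g (y : G) * `|f ((y : G)^-1 * (z : G))%g - f (z : G)| *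
     r ((z : G)^-1 * x)%g)%:E)%E; last first.
  rewrite E; apply: eq_integral => z _.
  under [RHS]eq_integral do rewrite EFinM.
  rewrite ge0_integralZr.
  - by [].
  - exact: measurableT.
  - apply/measurable_EFinP; apply: measurable_funM; first exact: mg.
    apply: measurableT_comp; first exact: normr_measurable.
    apply: measurable_funB; last exact: measurable_cst.
    apply: (measurable_comp_continuous _ (conv_density_measurable df)).
    apply: continuous_mulg; last exact: cst_continuous.
    exact: invg_continuous.
  - by move=> y _; rewrite lee_fin mulr_ge0.
  - by rewrite lee_fin.
apply: ge0_le_integral.
- exact: measurableT.
- by move=> y _; rewrite lee_fin.
- apply/measurable_EFinP; apply: measurableT_comp; first exact: normr_measurable.
  by apply: measurable_funB; apply: measurable_funM => //; exact: measurable_cst.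
- exact: m1.
- move=> y _; rewrite -mulrBr normrM (ger0_norm (g0 _)) EFinM.
  under eq_integral do rewrite -mulrA EFinM.
  rewrite ge0_integralZl.
  + by apply: lee_wpmul2l; [rewrite lee_fin|exact: phi_dist].
  + exact: measurableT.
  + apply/measurable_EFinP; apply: measurable_funM => //.
    apply: measurableT_comp; first exact: normr_measurable.
    apply: measurable_funB; last exact: (conv_density_measurable df).
    exact: (measurable_comp_continuous (continuous_mulgl (t := (y : G)^-1%g))
      (conv_density_measurable df)).
  + by move=> z _; rewrite lee_fin mulr_ge0.
  + by rewrite lee_fin.
Qed.

(** The dominating function itself is exported, with its measurability and support, because the
    right-hand estimate applies the inversion formula to it. *)
Lemma convol_left_estimate : exists k : borel G -> \bar R,
  [/\ measurable_fun [set: borel G] k, (forall x, 0 <= k x)%E,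
      exists2 B : set G, sigma_compact B & forall x, ~ B x -> k x = 0%E,
      forall x : G, (`|convol mu g phi x - phi x|%:E <= k x)%E &
      (\int[mu]_x k x =
        \int[mu]_y ((g (y : G))%:E * L1norm mu (ltrans (y : G) f \- f)%R))%E].
Proof.
have [C cC rC] := conv_density_supp dr.
have [A sA aA] := a_off.
have [mk kB kE] := ge0_conv_tonelli hausG haar_mu dr cC rC sA measurable_a a_ge0 aA.
exists k; split.
- exact: mk.
- move=> x; apply: integral_ge0 => z _; rewrite mule_ge0//.
  by rewrite lee_fin; exact: (conv_density_ge0 dr).
- exists [set (x * y)%g | x in A & y in C]; last exact: kB.
  by apply: sigma_compact_mul => //; exact: compact_sigma_compact.
- exact: convol_dist_le.
- by rewrite kE integral_a.
Qed.

End LeftEstimate.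

(** * Folner functions *)

Section Unif.
Context (R : realType) (G : topologicalGroupType).
Hypothesis hausG : hausdorff_space G.
Hypothesis lcG : locally_compact [set: G].
Variable mu : {measure set (borel G) -> \bar R}.
Hypothesis haar_mu : left_haar_measure mu.
Variable Delta : G -> R.
Hypothesis modDelta : modular_function mu Delta.

Lemma unif_ge0 (F : set G) (x : G) : 0 <= unif mu F x.
Proof. by rewrite /unif divr_ge0// fine_ge0. Qed.

Lemma unif_le (F : set G) (x : G) : unif mu F x <= (fine (mu F))^-1.
Proof.
by rewrite /unif indicE; case: (x \in F); rewrite ?mul1r ?mul0r// invr_ge0 fine_ge0.
Qed.

Lemma unif_off (F : set G) (x : G) : ~ F x -> unif mu F x = 0.
Proof. by move=> nFx; rewrite /unif indicE memNset// mul0r. Qed.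

Lemma measurable_unif (F : set G) : compact F ->
  measurable_fun [set: borel G] (unif mu F : borel G -> R).
Proof.
move=> cF; apply: measurable_funM; last exact: measurable_cst.
by apply: indic_borel; exact: compact_borel.
Qed.

Lemma integral_unif (F : set G) : compact F -> (0 < mu F)%E ->
  (\int[mu]_x (unif mu F (x : G))%:E = 1)%E.
Proof.
move=> cF F0; have mF := compact_borel hausG cF.
have Ffin := compact_measure_fin_num haar_mu cF.
have c0 : 0 < fine (mu F) by rewrite fine_gt0// F0 -ge0_fin_numE.
under eq_integral do rewrite /unif mulrC EFinM.
rewrite (ge0_integralZl mu measurableT (measurable_EFin_indic mF)).
- rewrite integral_indic_borel// -[X in (_ * X)%E]fineK// -EFinM.
  by rewrite mulVf// gt_eqF.
- by move=> x _; exact: EFin_indic_ge0.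
- by rewrite lee_fin invr_ge0 ltW.
Qed.

Lemma unif_density (F : set G) : compact F -> Gdelta F -> (0 < mu F)%E ->
  conv_density mu (unif mu F).
Proof.
move=> cF GF F0; split.
- exact: unif_ge0.
- by exists (fine (mu F))^-1; exact: unif_le.
- by exists F => //; exact: unif_off.
- exact: measurable_unif.
- move=> K L sK sL; apply: measurable_funM; last exact: measurable_cst.
  apply: (@measurable_indic_Gdelta _ _ hausG (fun p => (p.1^-1 * p.2)%g)) => //.
  apply: continuous_mulg; last exact: continuous_snd.
  by apply: continuous_invg; exact: continuous_fst.
- exact: integral_unif.
Qed.

Lemma ltrans_daggerE (f : G -> R) (t x y : G) :
  ltrans t (dagger Delta f) (y^-1 * x)%g =
  f (x^-1 * y * t)%g * Delta (x^-1 * y * t)%g.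
Proof. by rewrite /ltrans /dagger !invgM !invgK. Qed.

Let dagger_unif_bounded (F : set G) (t : G) : compact F ->
  exists M, forall x, ltrans t (dagger Delta (unif mu F)) x <= M.
Proof.
move=> cF; have [M MF] := compact_modular_function_bounded hausG haar_mu modDelta cF.
(* The maximum keeps the bound nonnegative even for empty [F], where [M] may be negative. *)
exists ((fine (mu F))^-1 * Num.max M 0) => x; rewrite /ltrans /dagger.
set w := (_^-1)%g; have [Fw|nFw] := pselect (F w); last first.
  rewrite unif_off// mul0r mulr_ge0// ?invr_ge0 ?fine_ge0//.
  by rewrite le_max lexx orbT.
apply: ler_pM; [exact: unif_ge0|
  exact: (modular_function_ge0 hausG haar_mu modDelta)|exact: unif_le|].
by rewrite le_max MF.
Qed.

Lemma measurable_dagger (f : G -> R) :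
  measurable_fun [set: borel G] (f : borel G -> R) ->
  measurable_fun [set: borel G] (dagger Delta f : borel G -> R).
Proof.
move=> mf; apply: measurable_funM.
  exact: (measurable_comp_continuous (@invg_continuous G) mf).
exact: (measurable_modular_functionV hausG haar_mu modDelta).
Qed.

Lemma dagger_ge0 (f : G -> R) : (forall x, 0 <= f x) ->
  forall x, 0 <= dagger Delta f x.
Proof.
by move=> f0 x; apply: mulr_ge0 => //; exact: (modular_function_ge0 hausG haar_mu modDelta).
Qed.

Lemma integral_dagger (f : G -> R) (S : set G) : sigma_compact S ->
  (forall x, ~ S x -> f x = 0) -> (forall x, 0 <= f x) ->
  measurable_fun [set: borel G] (f : borel G -> R) ->
  (\int[mu]_x (dagger Delta f (x : G))%:E = \int[mu]_x (f (x : G))%:E)%E.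
Proof.
move=> sS fS f0 mf.
have mf' : measurable_fun [set: borel G] (fun x : borel G => (f x)%:E : \bar R).
  exact/measurable_EFinP.
rewrite -(ge0_integral_invg hausG lcG haar_mu modDelta sS mf').
- by apply: eq_integral => x _; rewrite -EFinM.
- by move=> x; rewrite lee_fin.
- by move=> x /fS ->.
Qed.

Lemma dagger_unif_density (F : set G) (t : G) : compact F -> Gdelta F ->
  (0 < mu F)%E -> conv_density mu (ltrans t (dagger Delta (unif mu F))).
Proof.
move=> cF GF F0; have mu' := measurable_dagger (measurable_unif cF).
have u0 := dagger_ge0 (@unif_ge0 F).
split.
- by move=> x; exact: u0.
- exact: dagger_unif_bounded.
- exists [set (t * x)%g | x in [set x | F (x^-1)%g]].
    apply: compact_image; first exact: continuous_mulgl.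
    exact: compact_image_invg.
  move=> x nx; rewrite /ltrans /dagger unif_off ?mul0r// => Fx; apply: nx.
  by exists (t^-1 * x)%g => //; rewrite mulgA mulgV mul1g.
- exact: (measurable_comp_continuous (continuous_mulgl (t := t^-1%g)) mu').
- move=> K L sK sL.
  (* Multiplicativity splits [Delta] into functions of one variable, so that only the indicator of
     the G_delta set [F] mixes the variables. *)
  apply: (@eq_measurable_fun _ _ _ _ _ (fun p : borel G * borel G =>
     unif mu F ((p.2 : G)^-1 * (p.1 : G) * t)%g *
     (Delta ((p.2 : G)^-1)%g * Delta (p.1 : G) * Delta t))).
    by move=> p _; rewrite ltrans_daggerE !(modular_functionM hausG haar_mu modDelta).
  apply: measurable_funM.
    apply: measurable_funM; last exact: measurable_cst.
    apply: (@measurable_indic_Gdelta _ _ hausG (fun p => (p.2^-1 * p.1 * t)%g)) => //.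
    apply: continuous_mulg; last exact: cst_continuous.
    apply: continuous_mulg; last exact: continuous_fst.
    by apply: continuous_invg; exact: continuous_snd.
  apply: measurable_funTS; apply: measurable_funM; last exact: measurable_cst.
  apply: measurable_funM.
    apply: (@measurable_comp_snd G _ R (fun x : borel G => Delta (x : G)^-1%g)).
    exact: (measurable_modular_functionV hausG haar_mu modDelta).
  apply: (@measurable_comp_fst G _ R (Delta : borel G -> R)).
  exact: (measurable_modular_function hausG haar_mu modDelta).
- rewrite -(integral_unif cF F0).
  rewrite -(integral_dagger (compact_sigma_compact cF) (@unif_off F) (@unif_ge0 F)
    (measurable_unif cF)).
  move/measurable_EFinP in mu'.
  rewrite -[RHS](ge0_integral_mulgl haar_mu t^-1%g mu').
    by [].
  by move=> x; rewrite lee_fin; exact: u0.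
Qed.

End Unif.

(** * Modification on null sets *)

Section Null.
Context (R : realType) (G : topologicalGroupType).
Hypothesis hausG : hausdorff_space G.
Hypothesis lcG : locally_compact [set: G].
Variable mu : {measure set (borel G) -> \bar R}.
Hypothesis haar_mu : left_haar_measure mu.
Variable Delta : G -> R.
Hypothesis modDelta : modular_function mu Delta.

Lemma measurable_mulgl_set (t : G) (N : set (borel G)) : measurable N ->
  measurable ([set x | N (t * (x : G))%g] : set (borel G)).
Proof. by move=> mN; rewrite -[X in measurable X]setTI; exact: (@mulgl_borel G). Qed.

Lemma measurable_mulgr_set (t : G) (N : set (borel G)) : measurable N ->
  measurable ([set x | N ((x : G) * t)%g] : set (borel G)).
Proof. by move=> mN; rewrite -[X in measurable X]setTI; exact: (@mulgr_borel G). Qed.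

Section Hull.
Variables (F F' : set G).
Hypothesis cF : compact F.
Hypothesis cF' : compact F'.
Hypothesis FF' : F `<=` F'.
Hypothesis N0 : mu (F' `\` F) = 0%E.

Let mF := compact_borel hausG cF.
Let mF' := compact_borel hausG cF'.

Let mN : measurable (F' `\` F : set (borel G)).
Proof. exact: measurableD. Qed.

Lemma measure_hull : mu F' = mu F.
Proof.
apply/eqP; rewrite eq_le; apply/andP; split; last first.
  by apply: le_measure; rewrite ?inE.
have -> : F' = F `|` (F' `\` F) by rewrite setDUK.
by apply: le_trans (measureU2 mu mF mN) _; rewrite [X in (_ + X)%E]N0 adde0.
Qed.

Lemma unif_hull (x : G) : ~ (F' `\` F) x -> unif mu F x = unif mu F' x.
Proof.
move=> nN; rewrite /unif measure_hull !indicE; congr (_%:R / _); congr nat_of_bool.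
apply/idP/idP => /set_mem xF; apply/mem_set; first exact: FF'.
by apply: contrapT => nF; apply: nN.
Qed.

Let measurable_integrand (E : set G) (t x : G) : compact E ->
  measurable_fun [set: borel G] (fun y : borel G =>
    (unif mu E y * ltrans t (dagger Delta (unif mu E)) ((y : G)^-1 * x)%g)%:E : \bar R).
Proof.
move=> cE; apply/measurable_EFinP; apply: measurable_funM; first exact: measurable_unif.
have md := measurable_dagger hausG haar_mu modDelta (measurable_unif hausG mu cE).
apply: (measurable_comp_continuous _ md).
apply: continuous_mulg; first exact: cst_continuous.
apply: continuous_mulg; last exact: cst_continuous.
exact: invg_continuous.
Qed.

(** Equality holds at every x: the integrands differ only where y or x^-1 y t lies in the null set
    F' minus F, and translates of null sets are null. *)
Lemma convol_hull (t x : G) :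
  convol mu (unif mu F) (ltrans t (dagger Delta (unif mu F))) x =
  convol mu (unif mu F') (ltrans t (dagger Delta (unif mu F'))) x.
Proof.
have u0 E (y : borel G) : (0 <= (unif mu E y *
    ltrans t (dagger Delta (unif mu E)) ((y : G)^-1 * x)%g)%:E)%E.
  rewrite lee_fin; apply: mulr_ge0; first exact: unif_ge0.
  by apply: (dagger_ge0 hausG haar_mu modDelta) => z; exact: unif_ge0.
rewrite /convol /Rintegral; congr fine.
apply: ge0_ae_eq_integral.
- exact: measurableT.
- exact: measurable_integrand.
- exact: measurable_integrand.
- by move=> y _; exact: u0.
- by move=> y _; exact: u0.
pose N (y : borel G) := (F' `\` F) (x^-1 * (y : G) * t)%g.
have mNx : measurable (N : set (borel G)).
  exact: (@measurable_mulgl_set x^-1%g _ (@measurable_mulgr_set t _ mN)).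
exists ((F' `\` F) `|` N); split.
- exact: measurableU.
- apply/eqP; rewrite eq_le measure_ge0 andbT.
  apply: le_trans (measureU2 mu mN mNx) _.
  rewrite [X in (X + _)%E]N0 add0e.
  rewrite [X in (X <= _)%E](_ : _ = 0%E)//.
  apply: etrans (measure_mulgl haar_mu x^-1%g (@measurable_mulgr_set t _ mN)) _.
  by apply: etrans (measure_mulgr modDelta t mN) _; rewrite [X in (X * _)%E]N0 mul0e.
- move=> y; apply: contraPP => nN /= h; apply: h => _.
  have nN1 : ~ (F' `\` F) y by move=> ?; apply: nN; left.
  have nN2 : ~ (F' `\` F) (x^-1 * (y : G) * t)%g by move=> ?; apply: nN; right.
  by rewrite !ltrans_daggerE (unif_hull nN1) (unif_hull nN2).
Qed.

Lemma L1norm_ltrans_hull (y : G) :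
  L1norm mu (ltrans y (unif mu F) \- unif mu F) =
  L1norm mu (ltrans y (unif mu F') \- unif mu F').
Proof.
have m (E : set G) : compact E -> measurable_fun [set: borel G]
    (fun z : borel G => `|unif mu E (y^-1 * (z : G))%g - unif mu E z|%:E : \bar R).
  move=> cE; apply/measurable_EFinP; apply: measurableT_comp.
    exact: normr_measurable.
  apply: measurable_funB; last exact: measurable_unif.
  exact: (measurable_comp_continuous (continuous_mulgl (t := y^-1%g))
    (measurable_unif hausG mu cE)).
rewrite /L1norm !Lnorm1; apply: ge0_ae_eq_integral.
- exact: measurableT.
- exact: m.
- exact: m.
- by move=> z _; rewrite lee_fin.
- by move=> z _; rewrite lee_fin.
pose N (z : borel G) := (F' `\` F) (y^-1 * (z : G))%g.
have mNx : measurable (N : set (borel G)) by exact: measurable_mulgl_set.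
exists ((F' `\` F) `|` N); split.
- exact: measurableU.
- apply/eqP; rewrite eq_le measure_ge0 andbT.
  apply: le_trans (measureU2 mu mN mNx) _.
  rewrite [X in (X + _)%E]N0 add0e.
  rewrite [X in (X <= _)%E](_ : _ = 0%E)//.
  exact: etrans (measure_mulgl haar_mu y^-1%g mN) N0.
- move=> z; apply: contraPP => nN /= h; apply: h => _.
  have nN1 : ~ (F' `\` F) z by move=> ?; apply: nN; left.
  have nN2 : ~ (F' `\` F) (y^-1 * (z : G))%g by move=> ?; apply: nN; right.
  by rewrite /ltrans (unif_hull nN1) (unif_hull nN2).
Qed.

End Hull.

(** Inner regularity is available for open sets only, so [A] is first enclosed in an open set of
    finite measure, and the compact sets exhaust that one up to a null set. *)
Lemma finite_measure_sigma_compact (A : set (borel G)) : measurable A ->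
  (mu A < +oo)%E -> exists S N, [/\ sigma_compact (S : set G),
    measurable (N : set (borel G)), mu N = 0%E & A `<=` S `|` N].
Proof.
move=> mA Afin.
have : (mu A < mu A + 1)%E by rewrite lteDl ?lte01// ge0_fin_numE.
rewrite {1}(haar_outer haar_mu mA) => /ereal_inf_lt[_ [U [oU AU] <-] UA].
have Ufin : mu U \is a fin_num.
  rewrite ge0_fin_numE//; apply: lt_le_trans UA _.
  by rewrite leey.
have /choice[K KP] : forall n : nat, exists K : set G,
    [/\ compact K, K `<=` U & (mu U < mu K + (n.+1%:R^-1)%:E)%E].
  move=> n; have : (mu U - (n.+1%:R^-1)%:E < mu U)%E.
    by rewrite lteBlDr// lteDl// lte_fin invr_gt0.
  rewrite {2}(haar_inner haar_mu oU) => /ereal_sup_gt[_ [K [cK KU] <-] UK].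
  by exists K; split => //; rewrite -lteBlDr.
have sK : sigma_compact (\bigcup_n K n) by exists K => // n; have [] := KP n.
have mK := sigma_compact_borel hausG sK.
have mU := open_borel oU.
exists (\bigcup_n K n), (U `\` \bigcup_n K n); split => //.
- exact: measurableD.
- apply/eqP; rewrite eq_le measure_ge0 andbT; apply/lee_addgt0Pr => e e0.
  have [n ne] : exists n, n.+1%:R^-1 < e.
    by exists (Num.truncn e^-1); rewrite invf_plt ?posrE// truncnS_gt.
  have [cK KU UK] := KP n.
  have mKn := compact_borel hausG cK.
  rewrite add0e; apply: (@le_trans _ _ (mu (U `\` K n))).
    apply: le_measure; rewrite ?inE; [exact: measurableD..|].
    by move=> x [Ux nKx]; split => // Kx; apply: nKx; exists n.
  rewrite measureD ?setIidr//; last by rewrite -ge0_fin_numE.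
  rewrite leeBlDr; last exact: compact_measure_fin_num.
  by rewrite addeC; apply: (le_trans (ltW UK)); rewrite leeD2l// lee_fin ltW.
- by move=> x Ax; have [Kx|nKx] := pselect ((\bigcup_n K n) x); [left|right; split=> //; exact: AU].
Qed.

Lemma P1_sigma_compact (g : G -> R) : P1 mu g -> exists (g' : G -> R) (S N : set G),
  [/\ forall x, 0 <= g' x, measurable_fun [set: borel G] (g' : borel G -> R),
      (\int[mu]_x (g' (x : G))%:E = 1)%E,
      sigma_compact S /\ (forall x, ~ S x -> g' x = 0) &
      [/\ measurable (N : set (borel G)), mu N = 0%E &
          forall x, ~ N x -> g x = g' x]].
Proof.
move=> [L1g [N0 [mN0 N00 gN0]] g1].
have mg : measurable_fun [set: borel G] (g : borel G -> R).
  by move: L1g; rewrite /L1 /= inE => /andP[]; rewrite inE.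
have ing : (\int[mu]_x `|g x|%:E = 1)%E by rewrite -g1 /L1norm Lnorm1.
(* These sets exhaust the support of [g] and have finite measure by Chebyshev's inequality. *)
pose A n : set (borel G) := [set x | n.+1%:R^-1 < `|g x|].
have mng : measurable_fun [set: borel G] (fun x : borel G => `|g x|).
  by apply: measurableT_comp => //; exact: normr_measurable.
have mA n : measurable (A n).
  have := mng measurableT _ (measurable_itv `]n.+1%:R^-1, +oo[%R).
  rewrite setTI; congr measurable.
  by apply/seteqP; split=> x /=; rewrite in_itv /= andbT.
have A_fin n : (mu (A n) < +oo)%E.
  have : ((n.+1%:R^-1)%:E * mu (A n) <= 1)%E.
    rewrite -ing -(integral_indic_borel mu (mA n)).
    rewrite -(ge0_integralZl mu measurableT (measurable_EFin_indic (mA n))).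
    - apply: ge0_le_integral.
      + exact: measurableT.
      + by move=> x _; rewrite mule_ge0 ?lee_fin.
      + by apply: emeasurable_funM; [exact: measurable_cst|exact: measurable_EFin_indic (mA n)].
      + exact/measurable_EFinP.
      + move=> x _; rewrite -EFinM lee_fin indicE.
        case: (boolP (x \in A n)) => [/set_mem|_]; last by rewrite mulr0.
        by rewrite mulr1 /A /= => /ltW.
    - by move=> x _; exact: EFin_indic_ge0.
    - by rewrite lee_fin.
  rewrite ltey; apply: contraTneq => ->.
  by rewrite gt0_muley ?lte_fin ?invr_gt0// leye_eq.
have /choice[SN SNP] : forall n, exists SN : set G * set G,
    [/\ sigma_compact SN.1, measurable (SN.2 : set (borel G)), mu SN.2 = 0%E &
        A n `<=` SN.1 `|` SN.2].
  by move=> n; have [S [N []]] := finite_measure_sigma_compact (mA n) (A_fin n); exists (S, N).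
pose S := \bigcup_n (SN n).1.
pose N1 : set (borel G) := \bigcup_n (SN n).2.
have sS : sigma_compact S by apply: sigma_compact_bigcup => n; have [] := SNP n.
have mS := sigma_compact_borel hausG sS.
have mN1 : measurable N1 by apply: bigcup_measurable => n _; have [] := SNP n.
have N10 : mu N1 = 0%E.
  apply/(negligibleP mu mN1); apply: negligible_bigcup => n.
  by have [_ m m0 _] := SNP n; apply/(negligibleP mu m).
pose N : set (borel G) := N0 `|` N1.
have mN : measurable N by exact: measurableU.
have N_0 : mu N = 0%E.
  apply/eqP; rewrite eq_le measure_ge0 andbT.
  by apply: le_trans (measureU2 mu mN0 mN1) _;
    rewrite [X in (X + _)%E]N00 [X in (_ + X)%E]N10 adde0.
pose g' (x : G) : R := Num.max (g x) 0 * \1_S x.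
have g'0 x : 0 <= g' x by rewrite mulr_ge0// le_max lexx orbT.
have mg' : measurable_fun [set: borel G] (g' : borel G -> R).
  apply: measurable_funM; last exact: indic_borel.
  by apply: measurable_maxr => //; exact: measurable_cst.
have gg' x : ~ N x -> g x = g' x.
  move=> nN; have gx0 : 0 <= g x by apply: contrapT => h; apply: nN; left; exact: gN0.
  rewrite /g' (max_idPl gx0) indicE.
  have [/set_mem Sx|nSx] := boolP (x \in S); first by rewrite mulr1.
  rewrite mulr0; apply/eqP; apply: contraPT nN => gx nN; move/negP: nSx; apply.
  apply/mem_set; have {}gx0 : 0 < g x by rewrite lt_neqAle eq_sym gx.
  have Ax : A (Num.truncn (g x)^-1) x.
    by rewrite /A /= gtr0_norm// invf_plt ?posrE// truncnS_gt.
  have [_ _ _ /(_ x Ax)[Sx|Nx]] := SNP (Num.truncn (g x)^-1).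
    by exists (Num.truncn (g x)^-1).
  by exfalso; apply: nN; right; exists (Num.truncn (g x)^-1).
exists g', S, N; split => //.
- rewrite -ing; apply: ge0_ae_eq_integral.
  + exact: measurableT.
  + exact/measurable_EFinP.
  + exact/measurable_EFinP.
  + by move=> x _; rewrite lee_fin.
  + by move=> x _; rewrite lee_fin.
  exists N; split => // x; apply: contraPP => nN /= h; apply: h => _.
  by rewrite -gg'// ger0_norm// gg'.
- by split => // x nSx; rewrite /g' indicE memNset// mulr0.
Qed.

End Null.

(** Monotonicity straight from the supremum over simple functions. Measurability is not assumed, so
    it applies to norms whose dependence on the translation has not been shown measurable. *)
Lemma ge0_le_integral_pointwise d (T : measurableType d) (R : realType)
    (mu : {measure set T -> \bar R}) (f k : T -> \bar R) :
  (forall x, 0 <= f x)%E -> (forall x, f x <= k x)%E ->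
  (\int[mu]_x f x <= \int[mu]_x k x)%E.
Proof.
move=> f0 fk; have k0 x : (0 <= k x)%E by exact: le_trans (f0 x) (fk x).
rewrite !ge0_integralTE//; apply: le_ereal_sup => _ [h hf <-].
by exists h => // x; exact: le_trans (hf x) (fk x).
Qed.

(** The infinite case holds because both sides are then 0; convolutions can thus be compared before
    their finiteness is known. *)
Lemma fineZl (R : realType) (c : R) (I : \bar R) : 0 < c -> (0 <= I)%E ->
  fine (c%:E * I)%E = c * fine I.
Proof.
move=> c0; case: I => [r| |] //= _.
by rewrite gt0_muley ?lte_fin// mulr0.
Qed.

(** * Left and right translation estimates for the convolutions *)

Section Estimates.
Context (R : realType) (G : topologicalGroupType).
Hypothesis hausG : hausdorff_space G.
Hypothesis lcG : locally_compact [set: G].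
Variable mu : {measure set (borel G) -> \bar R}.
Hypothesis haar_mu : left_haar_measure mu.
Variable Delta : G -> R.
Hypothesis modDelta : modular_function mu Delta.
Variable F : set G.
Hypothesis cF : compact F.
Hypothesis GF : Gdelta F.
Hypothesis F0 : (0 < mu F)%E.

Let lam := unif mu F.
Let rho t := ltrans t (dagger Delta lam).
Let phi t := convol mu lam (rho t).

Let dlam : conv_density mu lam.
Proof. exact: unif_density. Qed.

Let drho t : conv_density mu (rho t).
Proof. exact: dagger_unif_density. Qed.

Let phi0 t x : 0 <= phi t x.
Proof. exact: convol_ge0 dlam (drho t) x. Qed.

Let mphi t : measurable_fun [set: borel G] (phi t : borel G -> R).
Proof. by have [] := convol_density hausG haar_mu dlam (drho t). Qed.

Let Delta_gt0 t : 0 < Delta t.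
Proof.
rewrite lt_neqAle (modular_function_ge0 hausG haar_mu modDelta) andbT.
apply/eqP => D0; have := modular_functionV hausG haar_mu modDelta t.
by rewrite -D0 mul0r => /eqP; rewrite eq_sym oner_eq0.
Qed.

Section Density.
Variables (g : G -> R) (S : set G).
Hypothesis g0 : forall x, 0 <= g x.
Hypothesis mg : measurable_fun [set: borel G] (g : borel G -> R).
Hypothesis ig : (\int[mu]_x (g (x : G))%:E = 1)%E.
Hypothesis sS : sigma_compact S.
Hypothesis gS : forall x, ~ S x -> g x = 0.

Lemma left_translation_estimate (t : G) : (L1norm mu (convol mu g (phi t) \- phi t)%R <=
  \int[mu]_y ((g (y : G))%:E * L1norm mu (ltrans (y : G) lam \- lam)%R))%E.
Proof.
have [k [mk k0 _ kle <-]] :=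
  convol_left_estimate hausG haar_mu dlam (drho t) g0 mg ig sS gS.
rewrite /L1norm Lnorm1; apply: ge0_le_integral_pointwise => x.
  exact: abse_ge0.
exact: kle.
Qed.

Lemma dagger_supp : sigma_compact [set x | S (x^-1)%g].
Proof.
rewrite (_ : mkset _ = [set (x^-1)%g | x in S]).
  by apply: sigma_compact_image => //; exact: invg_continuous.
apply/seteqP; split=> [x Sx|_ [x Sx <-]]; last by rewrite /= invgK.
by exists x^-1%g => //; rewrite invgK.
Qed.

Lemma dagger_off (x : G) : ~ S (x^-1)%g -> dagger Delta g x = 0.
Proof. by move=> nS; rewrite /dagger gS// mul0r. Qed.

(** The substitution y -> x^-1 y t exchanges the two factors [lam] of the integrand, one coming from
    [lam] and one from its [dagger]. *)
Lemma unif_convol_dagger (t x : G) : phi t x = Delta (x^-1)%g * phi t^-1%g (x^-1)%g.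
Proof.
apply: EFin_inj; rewrite EFinM !(convolE dlam (drho _)).
pose h (y : borel G) : \bar R :=
  (lam (y : G) * rho t^-1%g ((y : G)^-1 * x^-1)%g)%:E.
have mh : measurable_fun [set: borel G] h.
  by apply/measurable_EFinP; exact: conv_density_integrand dlam (drho _) _.
have h0 y : (0 <= h y)%E.
  rewrite lee_fin; apply: mulr_ge0; first exact: (conv_density_ge0 dlam).
  exact: (conv_density_ge0 (drho _)).
pose h' (y : borel G) : \bar R := h (x^-1 * (y : G))%g.
have mh' : measurable_fun [set: borel G] h'.
  exact: (measurable_comp_continuous (continuous_mulgl (t := x^-1%g)) mh).
have E1 : (\int[mu]_y h y = \int[mu]_y h' y)%E.
  by rewrite -(ge0_integral_mulgl haar_mu x^-1%g mh).
have E2 : (\int[mu]_y h' ((y : G) * t)%g = (Delta t^-1%g)%:E * \int[mu]_y h' y)%E.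
  exact: (ge0_integral_mulgr hausG haar_mu modDelta t mh' (fun y => h0 _)).
have mht : measurable_fun [set: borel G] (fun y : borel G => h' ((y : G) * t)%g).
  exact: (measurable_comp_continuous (continuous_mulgr (t := t)) mh').
(* Delta(x^-1) Delta(t) is the ratio between Delta(x^-1 y t) and Delta(y); its second factor is
   cancelled by the right translation by t. *)
transitivity (\int[mu]_y ((Delta x^-1%g * Delta t)%:E * h' ((y : G) * t)%g))%E.
  apply: eq_integral => y _; rewrite /h' /h -EFinM; congr (_%:E).
  rewrite /rho !ltrans_daggerE !invgK !mulgA mulgV mul1g -(mulgA _ t) mulgV mulg1.
  rewrite !(modular_functionM hausG haar_mu modDelta) /lam.
  by ring.
rewrite (ge0_integralZl mu measurableT mht).
- rewrite E2 -E1 muleA -EFinM -mulrA (modular_functionV hausG haar_mu modDelta).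
  by rewrite mulr1.
- by move=> y _; exact: h0.
- by rewrite lee_fin mulr_ge0// ltW.
Qed.

(** An instance of the rule that [dagger] reverses convolutions, obtained by the substitution y -> x
    y. *)
Lemma convol_unif_dagger (t x : G) : convol mu (phi t) g x =
  Delta (x^-1)%g * convol mu (dagger Delta g) (phi t^-1%g) (x^-1)%g.
Proof.
have mu1 : measurable_fun [set: borel G]
    (fun y : borel G => (phi t y * g ((y : G)^-1 * x)%g)%:E : \bar R).
  apply/measurable_EFinP; apply: measurable_funM; first exact: mphi.
  apply: (measurable_comp_continuous _ mg).
  apply: continuous_mulg; last exact: cst_continuous.
  exact: invg_continuous.
have mu2 : measurable_fun [set: borel G] (fun y : borel G =>
    (dagger Delta g y * phi t^-1%g ((y : G)^-1 * x^-1)%g)%:E : \bar R).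
  apply/measurable_EFinP; apply: measurable_funM.
    exact: (measurable_dagger hausG haar_mu modDelta mg).
  apply: (measurable_comp_continuous _ (mphi _)).
  apply: continuous_mulg; last exact: cst_continuous.
  exact: invg_continuous.
have gd0 := dagger_ge0 hausG haar_mu modDelta g0.
rewrite /convol /Rintegral -fineZl//; last first.
  by apply: integral_ge0 => y _; rewrite lee_fin mulr_ge0.
congr fine.
rewrite -(ge0_integralZl mu measurableT mu2); last 2 first.
- by move=> y _; rewrite lee_fin mulr_ge0.
- by rewrite lee_fin ltW.
rewrite -(ge0_integral_mulgl haar_mu x mu1); last first.
  by move=> y; rewrite lee_fin mulr_ge0.
apply: eq_integral => y _; rewrite -EFinM; congr (_%:E).
rewrite unif_convol_dagger invgM !(modular_functionM hausG haar_mu modDelta) /dagger.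
rewrite -(mulgA _ x^-1%g x) mulVg mulg1.
by ring.
Qed.

Lemma right_translation_estimate (t : G) : (L1norm mu (convol mu (phi t) g \- phi t)%R <=
  \int[mu]_y ((dagger Delta g (y : G))%:E * L1norm mu (ltrans (y : G) lam \- lam)%R))%E.
Proof.
have gd0 := dagger_ge0 hausG haar_mu modDelta g0.
have mgd := measurable_dagger hausG haar_mu modDelta mg.
have igd : (\int[mu]_x (dagger Delta g (x : G))%:E = 1)%E.
  by rewrite (integral_dagger hausG lcG haar_mu modDelta sS gS g0 mg).
have [k [mk k0 [B sB kB] kle <-]] :=
  convol_left_estimate hausG haar_mu dlam (drho t^-1%g) gd0 mgd igd dagger_supp dagger_off.
(* The integral of [k] becomes that of Delta(x^-1) k(x^-1), the pointwise bound produced by the two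
   [dagger] identities. *)
rewrite -(ge0_integral_invg hausG lcG haar_mu modDelta sB mk k0 kB).
rewrite /L1norm Lnorm1; apply: ge0_le_integral_pointwise => x.
  exact: abse_ge0.
rewrite /= convol_unif_dagger unif_convol_dagger -mulrBr normrM (gtr0_norm (Delta_gt0 _)).
rewrite mulrC EFinM; apply: lee_wpmul2r; first by rewrite lee_fin ltW.
exact: kle.
Qed.

End Density.

Section AlmostEverywhere.
Variables (g g' : G -> R) (N : set G).
Hypothesis mg : measurable_fun [set: borel G] (g : borel G -> R).
Hypothesis mg' : measurable_fun [set: borel G] (g' : borel G -> R).
Hypothesis mN : measurable (N : set (borel G)).
Hypothesis N0 : mu (N : set (borel G)) = 0%E.
Hypothesis gg' : forall x, ~ N x -> g x = g' x.

Let minvx (x : G) : continuous (fun y : G => (y^-1 * x)%g).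
Proof.
apply: continuous_mulg; last exact: cst_continuous.
exact: invg_continuous.
Qed.

Lemma convol_ae_left (t x : G) : convol mu g (phi t) x = convol mu g' (phi t) x.
Proof.
have mphix := measurable_comp_continuous (@minvx x) (mphi t).
rewrite /convol /Rintegral; congr fine; apply: ae_eq_integral.
- exact: measurableT.
- by apply/measurable_EFinP; exact: measurable_funM.
- by apply/measurable_EFinP; exact: measurable_funM.
exists N; split => // y; apply: contraPP => nN /= h; apply: h => _.
by rewrite gg'.
Qed.

Lemma convol_ae_right (t x : G) : convol mu (phi t) g x = convol mu (phi t) g' x.
Proof.
have [_ _ [C cC phiC]] := convol_density hausG haar_mu dlam (drho t).
rewrite /convol /Rintegral; congr fine; apply: ae_eq_integral.
- exact: measurableT.
- apply/measurable_EFinP; apply: measurable_funM; first exact: mphi.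
  exact: (measurable_comp_continuous (@minvx x) mg).
- apply/measurable_EFinP; apply: measurable_funM; first exact: mphi.
  exact: (measurable_comp_continuous (@minvx x) mg').
(* The integrands differ only where y^-1 x lies in [N], the inverse of a null set. The inversion
   formula covers sets inside a sigma-compact set, whence the cut by the compact support [C] of
   [phi t]. *)
pose A : set (borel G) := [set y | N ((y : G) * x)%g] `&` [set y : G | C (y^-1)%g].
have mNx := @measurable_mulgr_set G x _ mN.
have cCi := compact_image_invg cC.
have mCi := compact_borel hausG cCi.
have mA : measurable A by exact: measurableI.
have A0 : mu A = 0%E.
  apply/eqP; rewrite eq_le measure_ge0 andbT.
  apply: (@le_trans _ _ (mu [set y | N ((y : G) * x)%g])).
    apply: le_measure; first by rewrite inE.
      by rewrite inE; exact: mNx.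
    by move=> y [].
  by rewrite (measure_mulgr modDelta x mN) N0 mul0e.
exists [set y | A ((y : G)^-1)%g]; split.
- exact: measurable_invg.
- rewrite (measure_invg hausG lcG haar_mu modDelta (compact_sigma_compact cCi) mA).
    rewrite (ge0_negligible_integral mA mA _ _ A0).
    - by rewrite setDv integral_set0.
    - apply: measurable_funTS; apply/measurable_EFinP.
      exact: (measurable_modular_functionV hausG haar_mu modDelta).
    - by move=> y _; rewrite lee_fin ltW.
  by move=> y [].
move=> y; apply: contraPP => nA /= h; apply: h => _.
have [Cy|nCy] := pselect (C y); last first.
  have -> : phi t y = 0 by exact: phiC.
  by rewrite !mul0r.
rewrite gg'// => Ny; apply: nA; split; first exact: Ny.
by rewrite /= invgK.
Qed.

End AlmostEverywhere.

End Estimates.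

Lemma net_cvg0 (R : realType) (I : Type) (D : set I) (le : I -> I -> Prop)
    (f : I -> \bar R) : (forall i, 0 <= f i)%E ->
  (forall e : R, 0 < e ->
    exists2 i0, D i0 & forall i, D i -> le i0 i -> (f i <= e%:E)%E) ->
  f i @[i --> net_filter D le] --> 0%E.
Proof.
move=> f0 fe A [e /= e0 eA].
have [i0 Di0 i0P] := fe (e / 2) (divr_gt0 e0 (ltr0Sn R 1)).
exists i0 => // i Di i0i; have := i0P i Di i0i; have := f0 i; rewrite /=.
case: (f i) => [r|//|//]; rewrite !lee_fin => r0 re; apply: eA.
rewrite /= sub0r normrN ger0_norm//; apply: le_lt_trans re _.
by rewrite ltr_pdivrMr// ltr_pMr// ltr1n.
Qed.

(** * The averaged Folner condition *)

Section FolnerBound.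
Context (R : realType) (G : topologicalGroupType).
Hypothesis hausG : hausdorff_space G.
Variable mu : {measure set (borel G) -> \bar R}.
Hypothesis haar_mu : left_haar_measure mu.

Lemma L1norm_ltrans_unif_le2 (F : set G) (y : G) : compact F -> (0 < mu F)%E ->
  (L1norm mu (ltrans y (unif mu F) \- unif mu F)%R <= 2%:E)%E.
Proof.
move=> cF F0; rewrite /L1norm Lnorm1.
have mu1 : measurable_fun [set: borel G] (fun z : borel G => (unif mu F z)%:E : \bar R).
  by apply/measurable_EFinP; exact: measurable_unif.
have mu2 : measurable_fun [set: borel G]
    (fun z : borel G => (unif mu F (y^-1 * (z : G))%g)%:E : \bar R).
  exact: (measurable_comp_continuous (continuous_mulgl (t := y^-1%g)) mu1).
have u0 z : (0 <= (unif mu F z)%:E)%E by rewrite lee_fin unif_ge0.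
apply: (@le_trans _ _ (\int[mu]_z ((unif mu F (y^-1 * (z : G))%g)%:E +
    (unif mu F (z : G))%:E))%E).
  apply: ge0_le_integral_pointwise => z; first exact: abse_ge0.
  rewrite /= /ltrans -EFinD lee_fin; apply: le_trans (ler_normB _ _) _.
  by rewrite !ger0_norm// unif_ge0.
rewrite ge0_integralD.
- rewrite [X in (X + _)%E](ge0_integral_mulgl haar_mu y^-1%g mu1 u0).
  by rewrite integral_unif// -EFinD.
- exact: measurableT.
- by move=> z _; exact: u0.
- exact: mu2.
- by move=> z _; exact: u0.
- exact: mu1.
Qed.

Variables (calK : set (set G)) (F : set G * nat -> set G).
Hypothesis folnerF : folner_net mu calK F.

(** The interiors of members of [calK] cover the group, and [calK] is closed under finite unions. *)
Lemma compact_sub_calK (L : set G) : compact L -> exists2 K, calK K & L `<=` K.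
Proof.
move=> cL.
have cov x : exists2 K, calK K & K° x.
  have : [set: G] x by [].
  by rewrite -(folner_calK_cover folnerF) => -[K KK Kx]; exists K.
have [||x _|U LU [K KK UK]] := @compact_induction G
    (fun U => exists2 K, calK K & U `<=` K) L _ _ _ cL.
- by have [K KK _] := cov 1%g; exists K.
- move=> U V [K KK UK] [J JK VJ]; exists (K `|` J); last exact: setUSS.
  exact: (folner_calK_setU folnerF).
- have [K KK Kx] := cov x; exists K° => //.
    by apply: open_nbhs_nbhs; split => //; exact: open_interior.
  by exists K => //; exact: interior_subset.
- by exists K => //; exact: subset_trans UK.
Qed.

Variables (g : G -> R) (S : set G).
Hypothesis g0 : forall x, 0 <= g x.
Hypothesis mg : measurable_fun [set: borel G] (g : borel G -> R).
Hypothesis ig : (\int[mu]_x (g (x : G))%:E = 1)%E.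
Hypothesis sS : sigma_compact S.
Hypothesis gS : forall x, ~ S x -> g x = 0.

Let mgE : measurable_fun [set: borel G] (fun x : borel G => (g x)%:E : \bar R).
Proof. exact/measurable_EFinP. Qed.

Let g0E (x : borel G) : (0 <= (g x)%:E)%E.
Proof. by rewrite lee_fin. Qed.

Lemma density_tight (e : R) : 0 < e -> exists2 L : set G, compact L &
  (\int[mu]_(x in ~` (L : set (borel G))) (g (x : G))%:E <= e%:E)%E.
Proof.
move=> e0; have [K cK SK] := sS.
pose L n : set (borel G) := \big[setU/set0]_(i < n.+1) K i.
have cL n : compact (L n : set G).
  by rewrite /L; apply: bigsetU_compact => i _; exact: cK.
have mL n : measurable (L n) by exact: compact_borel.
have ndL : nondecreasing_seq L.
  move=> m n mn; apply/subsetPset; exact: subset_bigsetU.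
have UL : \bigcup_n L n = S.
  by rewrite SK; exact: bigcup_bigsetU_bigcup.
have cvgL : (\int[mu]_(x in L n) (g (x : G))%:E @[n --> \oo] -->
    \int[mu]_(x in \bigcup_n L n) (g (x : G))%:E)%E.
  apply: ge0_nondecreasing_set_cvg_integral.
  - exact: ndL.
  - exact: mL.
  - by move=> n; exact: measurable_funTS.
  - by move=> n x _; exact: g0E.
have iS : (\int[mu]_(x in \bigcup_n L n) (g (x : G))%:E = 1)%E.
  rewrite UL -ig integral_mkcond; apply: eq_integral => x _.
  by rewrite patchE; case: ifPn => //; rewrite notin_setE => /gS ->.
have [n _ /(_ n (leqnn n)) /= Ln] : \forall n \near \oo,
    ((1 - e)%:E < \int[mu]_(x in L n) (g (x : G))%:E)%E.
  rewrite iS in cvgL; apply: (cvgL [set x | ((1 - e)%:E < x)%E]).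
  apply: open_nbhs_nbhs; split; first exact: open_ereal_gt_ereal.
  by rewrite /= lte_fin gtrBl.
exists (L n) => //.
have : (\int[mu]_(x in L n) (g (x : G))%:E +
    \int[mu]_(x in ~` L n) (g (x : G))%:E = 1)%E.
  rewrite -ig -ge0_integral_setU.
  - by rewrite setUv.
  - exact: mL.
  - exact: measurableC.
  - exact: measurable_funTS.
  - by move=> x _; exact: g0E.
  - by apply/disj_setPCl.
have : (0 <= \int[mu]_(x in ~` L n) (g (x : G))%:E)%E.
  by apply: integral_ge0 => x _; exact: g0E.
move: Ln; case: (\int[mu]_(x in L n) _)%E => [a| |]//; last first.
  by case: (\int[mu]_(x in ~` L n) _)%E.
case: (\int[mu]_(x in ~` L n) _)%E => [b| |]//.
rewrite lte_fin !lee_fin -EFinD => a1 b0 [ab].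
by rewrite -(lerD2l a) ab -lerBlDr ltW.
Qed.

Lemma folner_bound (e : R) : 0 < e -> exists2 i0, folner_index calK i0 &
  forall i, folner_index calK i -> folner_le i0 i ->
    (\int[mu]_y ((g (y : G))%:E *
       L1norm mu (ltrans (y : G) (unif mu (F i)) \- unif mu (F i))%R) <= e%:E)%E.
Proof.
move=> e0.
(* Off [L] the translation norm is only known to be at most 2, so a tail of mass e / 4 costs e / 2;
   on [L] the Folner condition costs less than 1 / n0 < e / 2. *)
have [L cL Le] := density_tight (divr_gt0 e0 (ltr0n _ 4)).
have [K0 K0K LK0] := compact_sub_calK cL.
pose n0 := (Num.truncn (e / 2)^-1).+1.
have n0e : n0%:R^-1 < e / 2.
  by rewrite invf_plt ?posrE ?divr_gt0// truncnS_gt.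
exists (K0, n0) => // -[K n] Ki [/= K0K' n0n].
have mL := compact_borel hausG cL.
set i := (K, n).
have cFi := folner_compact folnerF Ki; have F0i := folner_pos folnerF Ki.
have mLC : measurable (~` (L : set (borel G))) by exact: measurableC.
apply: (@le_trans _ _ (\int[mu]_y ((e / 2)%:E * (g (y : G))%:E +
    2%:E * ((g (y : G))%:E * (\1_(~` L) (y : G))%:E)))%E).
  apply: ge0_le_integral_pointwise => y.
    by rewrite mule_ge0 ?lee_fin// Lnorm_ge0.
  have [Ly|nLy] := pselect (L y).
    apply: (@le_trans _ _ ((e / 2)%:E * (g y)%:E)%E); last first.
      by rewrite leeDl// mule_ge0// mule_ge0// lee_fin.
    rewrite muleC; apply: lee_wpmul2r; first exact: g0E.
    apply: ltW; apply: lt_trans (folner_lt folnerF Ki (K0K' _ (LK0 _ Ly))) _.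
    rewrite lte_fin; apply: le_lt_trans n0e; rewrite lef_pV2 ?posrE ?ltr0n//.
      by rewrite ler_nat.
    exact: leq_trans n0n.
  rewrite indicE mem_set// mule1.
  apply: (@le_trans _ _ (2%:E * (g y)%:E)%E); last first.
    by rewrite leeDr// mule_ge0// lee_fin divr_ge0// ltW.
  rewrite muleC; apply: lee_wpmul2r; first exact: g0E.
  exact: L1norm_ltrans_unif_le2.
have m1 : measurable_fun [set: borel G]
    (fun y : borel G => (g (y : G))%:E * (\1_(~` L) (y : G))%:E)%E.
  by apply: emeasurable_funM => //; exact: measurable_EFin_indic.
have g1 (y : borel G) : (0 <= (g (y : G))%:E * (\1_(~` L) (y : G))%:E)%E.
  by rewrite mule_ge0// lee_fin.
rewrite ge0_integralD.
- rewrite (ge0_integralZl mu measurableT mgE); [|by move=> *|by rewrite lee_fin divr_ge0// ltW].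
  rewrite (ge0_integralZl mu measurableT m1); [|by move=> *|by rewrite lee_fin].
  rewrite ig mule1.
  have -> : (\int[mu]_x ((g (x : G))%:E * (\1_(~` L) (x : G))%:E) =
      \int[mu]_(x in ~` (L : set (borel G))) (g (x : G))%:E)%E.
    rewrite [RHS]integral_mkcond; apply: eq_integral => x _.
    by rewrite patchE indicE; case: ifPn => _; rewrite ?mule1 ?mule0.
  apply: (@le_trans _ _ ((e / 2)%:E + 2%:E * (e / 4%:R)%:E)%E).
    by apply: leeD => //; apply: lee_wpmul2l => //; rewrite lee_fin.
  rewrite -EFinM -EFinD lee_fin.
  by rewrite (_ : e / 2 + _ = e)//; field.
- exact: measurableT.
- by move=> y _; rewrite mule_ge0// lee_fin divr_ge0// ltW.
- by apply: emeasurable_funM => //; exact: measurable_cst.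
- by move=> y _; rewrite mule_ge0// lee_fin.
- by apply: emeasurable_funM => //; exact: measurable_cst.
Qed.

End FolnerBound.

(** * Support, invariance and orthogonality of the net *)

Section Conclusion.
Context (R : realType) (G : topologicalGroupType).
Hypothesis hausG : hausdorff_space G.
Hypothesis lcG : locally_compact [set: G].
Variable mu : {measure set (borel G) -> \bar R}.
Hypothesis haar_mu : left_haar_measure mu.
Variable Delta : G -> R.
Hypothesis modDelta : modular_function mu Delta.

Let phi (F : set G) (t : G) :=
  convol mu (unif mu F) (ltrans t (dagger Delta (unif mu F))).

(** A nonzero integrand needs y and z = x^-1 y t in [F], and then x = y t z^-1; outside this set the
    integrand vanishes identically. *)
Lemma supp_convol (F : set G) (t : G) : supp (phi F t) `<=` FtFinv F t.
Proof.
move=> x /=; apply: contraPP => nx; apply/negP; rewrite negbK; apply/eqP.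
rewrite /phi /convol /Rintegral (_ : (\int[mu]_y _ = 0)%E)//.
apply: integral0_eq => y _; rewrite ltrans_daggerE.
have [Fy|nFy] := pselect (F y); last by rewrite unif_off// mul0r.
rewrite (@unif_off _ _ mu F (x^-1 * y * t)%g) ?mul0r ?mulr0// => Fz; apply: nx.
exists y => //; exists (x^-1 * y * t)%g => //.
by rewrite !invgM invgK !mulgA -(mulgA _ t) mulgV mulg1 mulgV mul1g.
Qed.

(* The null modification [F'] is needed because [1_F (x^-1 * y * t)] may fail
   to be measurable for the product of the Borel sigma-algebras. *)
Let Gdelta_replacement (F : set G) : compact F -> (0 < mu F)%E ->
  exists F', [/\ compact F', Gdelta F', (0 < mu F')%E,
    forall t, phi F t = phi F' t &
    forall y, L1norm mu (ltrans y (unif mu F) \- unif mu F) =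
      L1norm mu (ltrans y (unif mu F') \- unif mu F')].
Proof.
move=> cF F0; have [F' [cF' GF' FF' N0]] := compact_Gdelta_hull hausG lcG haar_mu cF.
exists F'; split => //.
- by rewrite (measure_hull hausG cF cF' FF' N0).
- move=> t; apply/funext => x.
  exact: (convol_hull hausG haar_mu modDelta cF cF' FF' N0).
- by move=> y; exact: (L1norm_ltrans_hull hausG haar_mu cF cF' FF' N0).
Qed.

Variables (calK : set (set G)) (F : set G * nat -> set G).
Hypothesis folnerF : folner_net mu calK F.

Lemma folner_convol_P1 (t : set G * nat -> G) :
  net_in_P1 mu (folner_index calK) (fun i => phi (F i) (t i)).
Proof.
move=> i Di.
have [F' [cF' GF' F'0 -> _]] :=
  Gdelta_replacement (folner_compact folnerF Di) (folner_pos folnerF Di).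
apply: (convol_P1 hausG haar_mu); first exact: unif_density.
exact: dagger_unif_density.
Qed.

Lemma folner_convol_left_TI (t : set G * nat -> G) :
  left_TI_net mu (folner_index calK) folner_le (fun i => phi (F i) (t i)).
Proof.
split=> [|g Pg]; first exact: folner_convol_P1.
have [g' [S [N [g'0 mg' ig' [sS gS] [mN N0 gg']]]]] :=
  P1_sigma_compact hausG haar_mu Pg.
have mg : measurable_fun [set: borel G] (g : borel G -> R).
  by case: Pg; rewrite /L1 /= inE => /andP[+ _ _]; rewrite inE.
apply: net_cvg0 => [i|e e0]; first exact: Lnorm_ge0.
have [i0 Di0 i0P] := folner_bound hausG haar_mu folnerF g'0 mg' ig' sS gS e0.
exists i0 => // i Di i0i; apply: le_trans (i0P i Di i0i).
have [F' [cF' GF' F'0 phiE normE]] :=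
  Gdelta_replacement (folner_compact folnerF Di) (folner_pos folnerF Di).
rewrite phiE; under eq_integral do rewrite normE.
have -> : convol mu g (phi F' (t i)) = convol mu g' (phi F' (t i)).
  apply/funext => x.
  exact: (convol_ae_left hausG lcG haar_mu modDelta cF' GF' F'0 mg mg' mN N0 gg').
exact: (left_translation_estimate hausG lcG haar_mu modDelta cF' GF' F'0 g'0 mg' ig' sS gS).
Qed.

Lemma folner_convol_right_TI (t : set G * nat -> G) :
  right_TI_net mu (folner_index calK) folner_le (fun i => phi (F i) (t i)).
Proof.
split=> [|g Pg]; first exact: folner_convol_P1.
have [g' [S [N [g'0 mg' ig' [sS gS] [mN N0 gg']]]]] :=
  P1_sigma_compact hausG haar_mu Pg.
have mg : measurable_fun [set: borel G] (g : borel G -> R).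
  by case: Pg; rewrite /L1 /= inE => /andP[+ _ _]; rewrite inE.
apply: net_cvg0 => [i|e e0]; first exact: Lnorm_ge0.
have gd0 := dagger_ge0 hausG haar_mu modDelta g'0.
have mgd := measurable_dagger hausG haar_mu modDelta mg'.
have igd : (\int[mu]_x (dagger Delta g' (x : G))%:E = 1)%E.
  by rewrite (integral_dagger hausG lcG haar_mu modDelta sS gS g'0 mg').
(* The left Folner condition is averaged against the [dagger] of [g'], again a density with
   sigma-compact support. *)
have [i0 Di0 i0P] := folner_bound hausG haar_mu folnerF gd0 mgd igd
  (dagger_supp sS) (dagger_off Delta gS) e0.
exists i0 => // i Di i0i; apply: le_trans (i0P i Di i0i).
have [F' [cF' GF' F'0 phiE normE]] :=
  Gdelta_replacement (folner_compact folnerF Di) (folner_pos folnerF Di).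
rewrite phiE; under eq_integral do rewrite normE.
have -> : convol mu (phi F' (t i)) g = convol mu (phi F' (t i)) g'.
  apply/funext => x.
  exact: (convol_ae_right hausG lcG haar_mu modDelta cF' GF' F'0 mg mg' mN N0 gg').
exact: (right_translation_estimate hausG lcG haar_mu modDelta cF' GF' F'0 g'0 mg' ig' sS gS).
Qed.

End Conclusion.

Unset Implicit Arguments.

Theorem lemma4p14 (R : realType) (G : topologicalGroupType)
  (hausG : hausdorff_space G)
  (lcG : locally_compact [set: G])
  (ncG : ~ compact [set: G])
  (mu : {measure set (borel G) -> \bar R})
  (haar_mu : left_haar_measure mu)
  (Delta : G -> R)
  (modDelta : modular_function mu Delta)
  (amenG : amenable mu)
  (calK : set (set G))
  (F : set G * nat -> set G)
  (folnerF : folner_net mu calK F) :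
  let Gam := folner_index calK in
  let lam gam := unif mu (F gam) in
  let rho gam := dagger Delta (lam gam) in
  exists t : set G * nat -> G,
    let phi gam := convol mu (lam gam) (ltrans (t gam) (rho gam)) in
    [/\ trivIset Gam (fun gam => FtFinv (F gam) (t gam)),
        forall gam, Gam gam -> supp (phi gam) `<=` FtFinv (F gam) (t gam),
        net_in_P1 mu Gam phi,
        orthogonal_net mu Gam phi &
        TI_net mu Gam folner_le phi].
Proof.
move=> Gam lam rho.
have [t tP] := disjoint_translates ncG (folner_calK_card folnerF)
  (folner_compact folnerF).
exists t => phi.
have supp_phi gam : supp (phi gam) `<=` FtFinv (F gam) (t gam) by exact: supp_convol.
split.
- exact: tP.
- by move=> gam _; exact: supp_phi.
- exact: (folner_convol_P1 hausG lcG haar_mu modDelta folnerF).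
(* Disjointness makes the product of the indicators vanish everywhere, not merely almost
   everywhere. *)
- move=> i j Di Dj ij; apply: aeW => x; rewrite !indicE.
  have [/set_mem/supp_phi xi|_] := boolP (x \in supp (phi i)); last by rewrite mul0r.
  have [/set_mem/supp_phi xj|_] := boolP (x \in supp (phi j)); last by rewrite mulr0.
  by exfalso; apply: ij; apply: tP => //; exists x.
- split.
  + exact: (folner_convol_left_TI hausG lcG haar_mu modDelta folnerF).
  + exact: (folner_convol_right_TI hausG lcG haar_mu modDelta folnerF).
Qed.
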